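(* Let $u=u(x;a,E,c)$ be a $T$-periodic traveling wave profile, let $\mathbf{M}(\mu)$ be the monodromy matrix of the eigenvalue problem $\partial_x\mathcal{L}[u]v=\mu v$, and let $D(\mu,\lambda)=\det(\mathbf{M}(\mu)-\lambda\mathbf{I})$ and $a(\mu)=\operatorname{tr}\mathbf{M}(\mu)$. If $a'''(0)=\operatorname{tr}(\mathbf{M}_{\mu\mu\mu}(0))>0$, then the number of roots of $\mu\mapsto D(\mu,1)$ on the positive real axis, counted with multiplicity, is odd. In particular, $\operatorname{spec}(\partial_x\mathcal{L}[u])\cap(\mathbb{R}\setminus\{0\})\neq\emptyset$, and the wave is spectrally unstable, i.e. $\operatorname{spec}(\partial_x\mathcal{L}[u])$ intersects the open right half plane.
   Context: Let $f\in C^2(\mathbb{R})$, $F'=f$, and for real parameters $(a,E,c)$ set $V(u;a,c)=F(u)-\frac{c}{2}u^2-au$. Standing assumption: $(a,E,c)$ lies in the interior of the parameter region for which $V(\cdot;a,c)$ has a local minimum and there are simple roots $u_-<u_+$ of $V(u;a,c)=E$ with $V(u;a,c)<E$ on $(u_-,u_+)$. Then $u(x)=u(x;a,E,c)$ denotes the nonconstant periodic solution of $\frac12u_x^2+V(u;a,c)=E$ (so $u_{xx}+f(u)-cu=a$) with $u(0)=u_-$, $u_x(0)=0$; it is a stationary solution of $u_t=u_{xxx}+(f(u))_x-cu_x$. Its period is $T=T(a,E,c)=2\int_{u_-}^{u_+}\frac{du}{\sqrt{2(E-V(u;a,c))}}$. Set $\mathcal{L}[u]=-\partial_x^2-f'(u)+c$.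 For $\mu\in\mathbb{C}$ let $\mathbf{M}(\mu)=\Phi(T,\mu)$, where $\Phi_x=\mathbf{H}(x;\mu)\Phi$, $\Phi(0,\mu)=\mathbf{I}$ ($3\times3$ identity) and $\mathbf{H}(x;\mu)=\begin{pmatrix}0&1&0\\0&0&1\\-\mu-u_xf''(u)&-f'(u)+c&0\end{pmatrix}$; this is the first order system for $\partial_x\mathcal{L}[u]v=\mu v$ in the variables $(v,v_x,v_{xx})$. The spectrum $\operatorname{spec}(\partial_x\mathcal{L}[u])$ is the set of $\mu\in\mathbb{C}$ for which $\partial_x\mathcal{L}[u]\psi=\mu\psi$ has a nontrivial bounded solution on $\mathbb{R}$, equivalently for which $D(\mu,\lambda)=0$ for some $\lambda\in\mathbb{C}$ with $|\lambda|=1$. Subscripts $\mu$ denote derivatives in $\mu$. *)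

(* Defs.v *)
From HB Require Import structures.
From mathcomp Require Export all_boot all_order all_algebra.
From mathcomp Require Export all_classical all_reals all_analysis.
From mathcomp.real_closed Require Export complex.

Set Implicit Arguments.
Unset Strict Implicit.
Unset Printing Implicit Defensive.

Export Order.TTheory GRing.Theory Num.Theory.
Export numFieldNormedType.Exports.

#[global] Open Scope classical_set_scope.
#[global] Open Scope ring_scope.
#[global] Open Scope complex_scope.

(* derive1 and derive1n are spelled out: in ring_scope ^`() and ^`(n) denote
   the formal derivatives of polynomials. *)

Section Profile.
Context {R : realType}.
Implicit Types (f F u : R -> R) (a E c um up T : R).

Definition C2 f : Prop :=
  [/\ forall x, derivable f x 1, forall x, derivable (derive1 f) x 1
    & continuous (derive1n 2 f)].

Definition potential F a c (v : R) : R := F v - c / 2 * v ^+ 2 - a * v.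

Definition local_minimum (g : R -> R) (v : R) : Prop :=
  \forall w \near v, g v <= g w.

Definition simple_root (g : R -> R) (y v : R) : Prop :=
  [/\ derivable g v 1, g v = y & derive1 g v != 0].

Definition potential_well F a E c um up : Prop :=
  [/\ um < up,
      simple_root (potential F a c) E um,
      simple_root (potential F a c) E up
    & forall v, um < v < up -> potential F a c v < E].

Definition parameter_region F : set (R * R * R) :=
  [set p : R * R * R | let: (a, E, c) := p in
    (exists v, local_minimum (potential F a c) v) /\
    (exists um up, potential_well F a E c um up)].

(* The energy equation alone does not determine u: its C^1 solutions may rest
   at um or up for an arbitrary time.  The second order equation rules this
   out, and together with the initial data it determines u. *)
Record wave_profile f F a E c um T u : Prop := WaveProfile {
  profile_derivable : forall x, derivable u x 1;
  profile_derivable2 : forall x, derivable (derive1 u) x 1;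
  profile_energy : forall x, (derive1 u x) ^+ 2 / 2 + potential F a c (u x) = E;
  profile_ode : forall x, derive1n 2 u x + f (u x) - c * u x = a;
  profile_init : u 0 = um;
  profile_init1 : derive1 u 0 = 0;
  profile_nonconstant : exists x y, u x != u y;
  profile_periodic : forall x, u (x + T) = u x }.

(* The improper integral of the positive function 1 / sqrt (2 (E - V)) over
   (um, up) is its Lebesgue integral. *)
Definition is_period F a E c um up T : Prop :=
  (T%:E = 2%:E * \int[lebesgue_measure]_(v in `]um, up[)
            ((Num.sqrt (2 * (E - potential F a c v)))^-1)%:E)%E.

End Profile.

Section Linearization.
Context {R : realType}.
Implicit Types (f u : R -> R) (c : R) (psi : R -> R[i]) (mu : R[i]).

(* Derivatives of complex-valued functions of a real variable. *)
Definition cderivable psi : Prop :=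
  forall x, derivable (fun y => complex.Re (psi y)) x 1 /\
            derivable (fun y => complex.Im (psi y)) x 1.

Definition cderive psi (x : R) : R[i] :=
  derive1 (fun y => complex.Re (psi y)) x +i*
  derive1 (fun y => complex.Im (psi y)) x.

Definition linop f c u psi (x : R) : R[i] :=
  - cderive (cderive psi) x - (derive1 f (u x))%:C * psi x + c%:C * psi x.

(* If psi is twice differentiable, then linop f c u psi is differentiable iff
   psi is three times differentiable, since f'(u) is C^1. *)
Definition eigen_solution f c u mu psi : Prop :=
  [/\ cderivable psi, cderivable (cderive psi), cderivable (linop f c u psi)
    & forall x, cderive (linop f c u psi) x = mu * psi x].

Definition spectrum f c u : set R[i] :=
  [set mu | exists psi,
    [/\ eigen_solution f c u mu psi,
        exists x, psi x != 0
      & exists K : R, forall x, `|psi x| <= K%:C]].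

Definition Hmx f c u (x : R) mu : 'M[R[i]]_3 :=
  \matrix_(i < 3, j < 3) nth 0 (nth [::]
    [:: [:: 0; 1; 0];
        [:: 0; 0; 1];
        [:: - mu - (derive1 u x * derive1n 2 f (u x))%:C;
            (- derive1 f (u x) + c)%:C; 0]]
    i) j.

Definition fundamental_matrix f c u (Phi : R -> R[i] -> 'M[R[i]]_3) : Prop :=
  forall mu,
    Phi 0 mu = 1%:M /\
    forall i j,
      cderivable (fun x => Phi x mu i j) /\
      forall x, cderive (fun y => Phi y mu i j) x
                = (Hmx f c u x mu *m Phi x mu) i j.

End Linearization.

Section Zeros.
Context {R : realType}.
Implicit Types (g : R[i] -> R[i]) (z : R[i]).

(* Iterated complex derivative; R[i]^o is R[i] as a normed space over itself. *)
Definition complex_derive1n (k : nat) g : R[i] -> R[i] :=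
  derive1n k (g : R[i] -> R[i]^o).

(* The order of vanishing at z of a g that is analytic. *)
Definition zero_order g z (m : nat) : Prop :=
  (forall k, (k < m)%N -> complex_derive1n k g z = 0) /\
  complex_derive1n m g z != 0.

Definition zero_count g (A : set R[i]) (n : nat) : Prop :=
  exists (s : seq R[i]) (m : R[i] -> nat),
    [/\ uniq s,
        forall z, z \in s <-> A z /\ g z = 0,
        forall z, z \in s -> zero_order g z (m z)
      & n = (\sum_(z <- s) m z)%N].

End Zeros.

(* Main.v *)
Require Import Defs.
From mathcomp Require Import ring lra.

Set Implicit Arguments.
Unset Strict Implicit.
Unset Printing Implicit Defensive.

(** The trace-free linear flow and the reflection x -> T - x, under which the profile is
    even, give D(mu, 1) = a(mu) - a(-mu), an odd entire function with real coefficients.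
    At mu = 0 the profile derivative spans a right null vector of M(0) - 1 and the first
    integral L v a left one; they pair to zero with M'(0) because the profile is periodic,
    so D'(0, 1) = 2 a'(0) = 0 and D(mu, 1) = a'''(0) mu^3 / 3 + ... is positive for small
    mu > 0.

    For large mu > 0 an indefinite quadratic form increases strictly along the flow, so
    det (Phi(x, mu) - 1) has no zero for 0 < x <= T; for small x it behaves like - mu x^3,
    hence D(mu, 1) < 0.  A real entire function that changes sign between 0+ and + infinity
    has, with multiplicities, an odd number of positive zeros, and each of them carries a
    T-periodic, hence bounded, eigenfunction. *)

(** * Real calculus and Gronwall *)

(** For a 3 by 3 matrix of determinant 1, [det (M - 1) = tr M - tr M^-1], and the reflection
    conjugates the inverse of M(mu) to M(-mu) by diag(1, -1, 1). Oddness settles the even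
    derivatives of D(mu, 1) at 0, so below order three only D'(0, 1) asks for information on the
    wave: it pairs the adjugate of M(0) - 1, built from the two null vectors, with M'(0). For large
    mu no asymptotics of solutions are needed. The rates of v''' = - mu v are the cube root of mu
    times -1 and exp(+- i pi / 3), none of them imaginary; hence a Lyapunov equation has a solution,
    which is the quadratic form. A vector fixed by Phi(x, mu) would bring the form back to its
    initial value. Analyticity is made explicit: variation of constants at mu = 0 writes M(mu) as a
    power series with real coefficients bounded by A B^n / n!. At real points its complex
    derivatives are real numbers, namely the derivatives of the restriction to the real axis, so
    multiplicities can be counted there. Finiteness of the zero set and parity of the count come
    together from a supremum argument on intervals. *)

Section RealCalculus.
Context {R : realType}.
Implicit Types (f g df dg : R -> R) (a b x K d : R).

Lemma is_derive_add f g x (df dg : R) : is_derive x 1 f df -> is_derive x 1 g dg ->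
  is_derive x 1 (fun y => f y + g y) (df + dg).
Proof. by move=> hf hg; exact: is_deriveD. Qed.

Lemma is_derive_mul f g x (df dg : R) : is_derive x 1 f df -> is_derive x 1 g dg ->
  is_derive x 1 (fun y => f y * g y) (df * g x + f x * dg).
Proof.
move=> hf hg; rewrite addrC [df * _]mulrC; exact: (is_deriveM hf hg).
Qed.

Lemma is_derive_const c x : is_derive x (1 : R) (fun _ => c : R) 0.
Proof. exact: is_derive_cst. Qed.

Lemma is_derive_scale f x (df : R) c : is_derive x 1 f df ->
  is_derive x 1 (fun y => c * f y) (c * df).
Proof.
by move=> hf; have := is_derive_mul (is_derive_const c x) hf; rewrite mul0r add0r.
Qed.

Lemma is_derive_opp f x (df : R) : is_derive x 1 f df ->
  is_derive x 1 (fun y => - f y) (- df).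
Proof. by move=> hf; exact: is_deriveN. Qed.

Lemma is_derive_affine f x (df : R) c e : is_derive (c * x + e) 1 f df ->
  is_derive x 1 (fun y => f (c * y + e)) (c * df).
Proof.
move=> hf.
have h : is_derive x 1 (fun y => c * y + e) c.
  have := is_derive_add (is_derive_scale c (is_derive_id x (1 : R))) (is_derive_const e x).
  by rewrite mulr1 addr0.
by rewrite mulrC; exact: (@is_derive1_comp R f (fun y => c * y + e) x df c hf h).
Qed.

Lemma is_derive_bigsum (I : finType) (f df : I -> R -> R) x :
  (forall i, is_derive x 1 (f i) (df i x)) ->
  is_derive x 1 (fun y => \sum_i f i y) (\sum_i df i x).
Proof.
move=> h; have -> : (fun y => \sum_i f i y) = \sum_i f i.
  by apply/funext => y; rewrite fct_sumE.
elim/big_ind2 : _ => [|g dg g' dg' hg hg'|i _]; last exact: h.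
  exact: is_derive_const.
exact: is_derive_add.
Qed.

Lemma is_derive_continuous f x (df : R) : is_derive x 1 f df -> {for x, continuous f}.
Proof. by move=> [h _]; apply: differentiable_continuous; exact/derivable1_diffP. Qed.

Lemma is_derive_unique f x (a b : R) : is_derive x 1 f a -> is_derive x 1 f b -> a = b.
Proof. by move=> [_ <-] [_ <-]. Qed.

Lemma le_of_derive f g df dg a b : a <= b ->
  (forall x, a <= x <= b -> is_derive x 1 f (df x)) ->
  (forall x, a <= x <= b -> is_derive x 1 g (dg x)) ->
  (forall x, a <= x <= b -> df x <= dg x) ->
  f b - f a <= g b - g a.
Proof.
move=> ab hf hg le.
have hd x : a <= x <= b -> is_derive x 1 (fun y => g y - f y) (dg x - df x).
  by move=> xab; apply: is_derive_add; [exact: hg|apply: is_derive_opp; exact: hf].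
have [] := @MVT_segment R (fun y => g y - f y) (fun y => dg y - df y) a b ab.
- by move=> x; rewrite in_itv /= => /andP[h1 h2]; apply: hd; rewrite !ltW.
- apply: continuous_in_subspaceT => x; rewrite inE /= in_itv /=.
  by move=> /hd /is_derive_continuous.
move=> c; rewrite in_itv /= => cab E.
have : 0 <= (dg c - df c) * (b - a) by rewrite mulr_ge0 ?subr_ge0 ?le.
by rewrite -E; lra.
Qed.

Lemma eq_of_derive f g df a b : a <= b ->
  (forall x, a <= x <= b -> is_derive x 1 f (df x)) ->
  (forall x, a <= x <= b -> is_derive x 1 g (df x)) ->
  f b - f a = g b - g a.
Proof.
by move=> ab hf hg; apply/le_anti/andP; split; exact: le_of_derive.
Qed.

Lemma norm_le_of_derive f g df dg a b : a <= b ->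
  (forall x, a <= x <= b -> is_derive x 1 f (df x)) ->
  (forall x, a <= x <= b -> is_derive x 1 g (dg x)) ->
  (forall x, a <= x <= b -> `|df x| <= dg x) ->
  `|f b - f a| <= g b - g a.
Proof.
move=> ab hf hg le; rewrite ler_norml; apply/andP; split.
  suff : - f b - - f a <= g b - g a by lra.
  apply: (@le_of_derive (fun y => - f y) g (fun y => - df y) dg) => // x xab.
    by apply: is_derive_opp; exact: hf.
  by have := le _ xab; rewrite ler_norml => /andP[]; lra.
apply: (@le_of_derive f g df dg) => // x xab.
by have := le _ xab; rewrite ler_norml => /andP[].
Qed.

(** The integral starts at -1 so that 0, where it is normalised, lies inside the half line on which
    the fundamental theorem of calculus gives a two-sided derivative. *)
Let prim g x := \int[lebesgue_measure]_(t in `[(-1), x]) g t -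
  \int[lebesgue_measure]_(t in `[(-1), 0]) g t.

Let primP g : continuous g -> forall x, -1 < x -> is_derive x 1 (prim g) (g x).
Proof.
move=> cg x x1.
have [] := @continuous_FTC1_closed R g (-1) x (x + 1).
- by rewrite ltrDl.
- apply: continuous_compact_integrable; first exact: segment_compact.
  by apply: continuous_subspaceT => y; exact: cg.
- exact: x1.
- exact: cg.
rewrite derive1E => h1 h2.
pose k := \int[lebesgue_measure]_(t in `[(-1), 0]) g t.
have := is_derive_add (DeriveDef h1 h2) (is_derive_opp (is_derive_const k x)).
by rewrite oppr0 addr0.
Qed.

(** To the left of -1 the primitive of the reflected function is used. The two pieces agree on (-1,
    0), since both have derivative [g] and vanish at 0, so the glued function is differentiable at
    -1 too. *)
Lemma antiderivative g : continuous g ->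
  exists G : R -> R, G 0 = 0 /\ forall x, is_derive x 1 G (g x).
Proof.
move=> cg.
pose h x := g (- x).
have ch : continuous h.
  by move=> x; apply: (@continuous_comp _ _ _ -%R g); [exact: opp_continuous|exact: cg].
have P0 k : prim k 0 = 0 by rewrite /prim subrr.
have dN x : x < 1 -> is_derive x 1 (fun y => - prim h (- y)) (g x).
  move=> x1; have := @is_derive_affine (prim h) x (h (- x)) (-1) 0.
  rewrite mulN1r addr0 => /(_ (primP ch _)) H.
  have -> : (fun y => - prim h (- y)) = (fun y => - prim h (-1 * y + 0)).
    by apply/funext => y; rewrite mulN1r addr0.
  have /H/is_derive_opp : -1 < - x by lra.
  by rewrite /h opprK mulN1r opprK.
have glue x : -1 < x < 0 -> prim g x = - prim h (- x).
  move=> /andP[x1 x2].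
  have : prim g 0 - prim g x = (- prim h (- 0)) - (- prim h (- x)).
    apply: (@eq_of_derive (prim g) (fun y => - prim h (- y)) g); first exact: ltW.
      by move=> y /andP[h1 h2]; apply: primP => //; lra.
    by move=> y /andP[h1 h2]; apply: dN; lra.
  by rewrite oppr0 !P0; lra.
exists (fun x => if -1 < x then prim g x else - prim h (- x)); split.
  by rewrite P0 ltrN10.
move=> x; have [x1|x1] := ltP (-1) x.
  apply: (@near_eq_is_derive _ _ _ (prim g)) => //; last exact: primP.
  near=> y; rewrite ifT //; near: y.
  exact: lt_nbhsr.
apply: (@near_eq_is_derive _ _ _ (fun y => - prim h (- y))) => //; last by apply: dN; lra.
near=> y; case: ifP => // y1; rewrite glue // y1 /=; near: y.
by apply: lt_nbhsl; lra.
Unshelve. all: by end_near. Qed.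

(** The energy E, the sum of the squares, satisfies E' <= L E + N d^2, by (sum |y_j|)^2 <= N E and 2
    |y_j| d <= y_j^2 + d^2; then E exp(- L t) grows at most linearly. Squares avoid differentiating
    absolute values, and the bound is proportional to d^2, so that small defects give small
    errors. *)
Lemma gronwall (I : finType) (y dy : I -> R -> R) K d b :
  0 <= K -> 0 <= d -> 0 <= b ->
  (forall i x, 0 <= x <= b -> is_derive x 1 (y i) (dy i x)) ->
  (forall i x, 0 <= x <= b -> `|dy i x| <= K * (\sum_j `|y j x|) + d) ->
  (forall i, y i 0 = 0) ->
  forall i x, 0 <= x <= b ->
    (y i x) ^+ 2 <= #|I|%:R * d ^+ 2 * b * expR ((2 * K * #|I|%:R + 1) * b).
Proof.
move=> K0 d0 b0 hy bnd y0 i x /andP[x0 xb].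
set N : R := #|I|%:R; set L := 2 * K * N + 1.
have N0 : 0 <= N by rewrite ler0n.
have L0 : 0 <= L by rewrite addr_ge0 // !mulr_ge0.
pose E x := \sum_j (y j x) ^+ 2.
pose dE x := \sum_j (dy j x * y j x + y j x * dy j x).
have hE (t : R) : 0 <= t <= b -> is_derive t 1 E (dE t).
  move=> tb; have -> : E = fun t => \sum_j (y j t * y j t).
    by apply/funext => ?; apply: eq_bigr => j _; rewrite expr2.
  apply: (@is_derive_bigsum I (fun j t => y j t * y j t)
    (fun j t => dy j t * y j t + y j t * dy j t)) => j.
  by apply: is_derive_mul; exact: hy.
have bE (t : R) : 0 <= t <= b -> dE t <= L * E t + N * d ^+ 2.
  move=> tb; set S := \sum_j `|y j t|.
  have S0 : 0 <= S by apply: sumr_ge0.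
  have SE : S ^+ 2 <= N * E t.
    rewrite expr2 {1}/S mulr_suml.
    have -> : N * E t = \sum_j \sum_(k : I) ((y j t) ^+ 2 + (y k t) ^+ 2) / 2.
      have -> : \sum_j \sum_(k : I) ((y j t) ^+ 2 + (y k t) ^+ 2) / 2 =
          \sum_j (N * (y j t) ^+ 2 + E t) / 2.
        apply: eq_bigr => j _; rewrite -mulr_suml big_split /= sumr_const.
        by rewrite -[_ *+ _]mulr_natl.
      rewrite -mulr_suml big_split /= sumr_const -mulr_sumr -/(E t).
      by rewrite -[_ *+ _]mulr_natl -/N; field.
    apply: ler_sum => j _; rewrite mulr_sumr; apply: ler_sum => k _.
    have := sqr_ge0 (`|y j t| - `|y k t|).
    rewrite sqrrB !real_normK ?num_real // => H.
    by rewrite ler_pdivlMr // -subr_ge0; apply: le_trans H _; lra.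
  have : dE t <= \sum_j (2 * `|y j t| * (K * S) + ((y j t) ^+ 2 + d ^+ 2)).
    apply: ler_sum => j _.
    have -> : dy j t * y j t + y j t * dy j t = 2 * (y j t * dy j t) by ring.
    apply: (@le_trans _ _ (2 * (`|y j t| * (K * S + d)))).
      rewrite ler_pM2l //; apply: le_trans (ler_norm _) _.
      by rewrite normrM ler_wpM2l // bnd.
    have := sqr_ge0 (`|y j t| - d).
    by rewrite sqrrB real_normK ?num_real //; lra.
  rewrite big_split /= big_split /= -mulr_suml -mulr_sumr -/S -/(E t) sumr_const.
  rewrite -mulr_natl -/N => H; apply: le_trans H _.
  suff : K * S ^+ 2 <= K * (N * E t) by rewrite /L; lra.
  exact: ler_wpM2l.
pose ex (t : R) := expR (- L * t).
have hex (t : R) : is_derive t 1 ex (- L * ex t).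
  have := @is_derive_affine (@expR R) t (expR (- L * t)) (- L) 0.
  rewrite addr0 => /(_ (is_derive_expR _)) H.
  move: H; have -> // : (fun y : R => expR (- L * y + 0)) = ex.
  by apply/funext => ?; rewrite /ex addr0.
have : E x * ex x - E 0 * ex 0 <= N * d ^+ 2 * x - N * d ^+ 2 * 0.
  apply: (@le_of_derive (fun t => E t * ex t) (fun t => N * d ^+ 2 * t)
    (fun t => dE t * ex t + E t * (- L * ex t)) (fun t => N * d ^+ 2 * 1)) => //.
    by move=> t /andP[t0 tx]; apply: is_derive_mul => //; apply: hE; rewrite t0 (le_trans tx).
  move=> t /andP[t0 tx]; have tb : 0 <= t <= b by rewrite t0 (le_trans tx).
  have -> : dE t * ex t + E t * (- L * ex t) = (dE t - L * E t) * ex t by ring.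
  have e1 : ex t <= 1 by rewrite /ex -expR0 ler_expR mulNr oppr_le0 mulr_ge0.
  have e0 : 0 <= ex t by exact: expR_ge0.
  have := bE t tb; rewrite -lerBlDl => H.
  apply: (@le_trans _ _ (N * d ^+ 2 * ex t)); first exact: ler_wpM2r.
  by apply: ler_wpM2l => //; rewrite mulr_ge0 // sqr_ge0.
have -> : E 0 = 0 by apply: big1 => j _; rewrite y0 expr0n.
rewrite mul0r mulr0 !subr0 => H.
have yE : (y i x) ^+ 2 <= E x.
  by rewrite /E (bigD1 i) //= lerDl; apply: sumr_ge0 => j _; exact: sqr_ge0.
apply: le_trans yE _.
have -> : E x = E x * ex x * expR (L * x).
  by rewrite -mulrA /ex -expRD mulNr addNr expR0 mulr1.
apply: ler_pM; first by rewrite mulr_ge0 ?expR_ge0 // sumr_ge0 // => j _; exact: sqr_ge0.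
- exact: expR_ge0.
- by apply: le_trans H _; apply: ler_wpM2l => //; rewrite mulr_ge0 // sqr_ge0.
- by rewrite ler_expR; apply: ler_wpM2l.
Qed.

Lemma gronwall0 (I : finType) (y dy : I -> R -> R) K b :
  0 <= K -> 0 <= b ->
  (forall i x, 0 <= x <= b -> is_derive x 1 (y i) (dy i x)) ->
  (forall i x, 0 <= x <= b -> `|dy i x| <= K * (\sum_j `|y j x|)) ->
  (forall i, y i 0 = 0) ->
  forall i x, 0 <= x <= b -> y i x = 0.
Proof.
move=> K0 b0 hy bnd y0 i x xb.
have bnd' j t : 0 <= t <= b -> `|dy j t| <= K * (\sum_j `|y j t|) + 0.
  by rewrite addr0; exact: bnd.
have := gronwall K0 (lexx 0) b0 hy bnd' y0 i xb.
rewrite expr0n /= mulr0 !mul0r => H.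
by apply/eqP; rewrite -sqrf_eq0; apply/eqP/le_anti; rewrite H sqr_ge0.
Qed.

End RealCalculus.

(** * Counting zeros of a real function through its derivatives *)

Section Tower.
Context {R : realType}.
Implicit Types (p : nat -> R -> R) (x y z r : R) (m n : nat).

Definition tower p := forall k x, is_derive x 1 (p k) (p k.+1 x).

Definition order_at p x n := (forall j, (j < n)%N -> p j x = 0) /\ p n x != 0.

Lemma tower_shift p : tower p -> tower (fun k => p k.+1).
Proof. by move=> hp k x; exact: hp. Qed.

Lemma tower_continuous p k : tower p -> continuous (p k).
Proof. by move=> hp x; exact: (is_derive_continuous (hp k x)). Qed.

Lemma mvt_oo (f df : R -> R) (a b : R) : a < b -> (forall x : R, is_derive x 1 f (df x)) ->
  exists2 c, a < c < b & f b - f a = df c * (b - a).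
Proof.
move=> ab hf.
have [] := @MVT R f df a b ab.
  by apply: continuous_subspaceT => x; exact: (is_derive_continuous (hf x)).
by move=> c; rewrite in_itv /=; exists c.
Qed.

(** Induction on [n] through the shifted tower: the mean value theorem passes the sign of the
    derivative to the function. To the left of [r] each passage flips the sign, whence the factor
    (-1)^n. *)
Lemma tower_sign_pos p n r : tower p -> (forall j, (j < n)%N -> p j r = 0) ->
  0 < p n r ->
  exists2 d, 0 < d & forall x, (r < x < r + d -> 0 < p 0%N x) /\
    (r - d < x < r -> 0 < (-1) ^+ n * p 0%N x).
Proof.
elim: n p => [|n IH] p hp p0 pn.
  have /cvgrPdist_lt/(_ _ pn) := tower_continuous (k := 0) hp (x := r).
  move=> /nbhs_ballP[d /= d0 hd]; exists d => // x.
  have key : `|r - x| < d -> 0 < p 0%N x.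
    by move=> /hd /=; rewrite ltr_norml => /andP[_]; lra.
  rewrite expr0 mul1r.
  by split => /andP[h1 h2]; apply: key; rewrite ltr_norml; apply/andP; split; lra.
have [||d d0 hd] := IH _ (tower_shift hp) => //.
  by move=> j jn; exact: p0.
exists d => // x; have p0r : p 0%N r = 0 by exact: p0.
split => /andP[h1 h2].
  have [c /andP[c1 c2]] := mvt_oo h1 (hp 0%N).
  rewrite p0r subr0 => ->; rewrite mulr_gt0 ?subr_gt0 //.
  by have [+ _] := hd c; apply; rewrite c1 (lt_trans c2).
have [c /andP[c1 c2]] := mvt_oo h2 (hp 0%N).
rewrite p0r sub0r => E; have -> : p 0%N x = - (p 1%N c * (r - x)) by rewrite -E opprK.
rewrite exprS mulN1r mulrNN mulrA mulr_gt0 ?subr_gt0 //.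
by have [_] := hd c; apply; rewrite c2 (lt_trans h1).
Qed.

Lemma tower_sign p n r : tower p -> order_at p r n ->
  exists2 d, 0 < d & forall x y, r - d < x < r -> r < y < r + d ->
    0 < (-1) ^+ n * (p 0%N x * p 0%N y).
Proof.
move=> hp [p0 pn].
wlog pos : p hp p0 pn / 0 < p n r.
  move=> H; have [h|h] := ltP 0 (p n r); first exact: H.
  have [||||d d0 hd] := H (fun k x => - p k x).
  - by move=> k x; apply: is_derive_opp; exact: hp.
  - by move=> j /p0 ->; rewrite oppr0.
  - by rewrite oppr_eq0.
  - by rewrite oppr_gt0 lt_neqAle pn.
  by exists d => // x y h1 h2; rewrite -[p 0%N x * _]mulrNN; exact: hd.
have [d d0 hd] := tower_sign_pos hp p0 pos.
exists d => // x y h1 h2; rewrite mulrA mulr_gt0 //.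
  by have [_] := hd x; exact.
by have [+ _] := hd y; exact.
Qed.

Lemma is_derive_expn_fact r n x :
  is_derive x 1 (fun y => (y - r) ^+ n.+1 / n.+1`!%:R) ((x - r) ^+ n / n`!%:R).
Proof.
have h1 : is_derive x 1 (fun y => y - r) 1.
  by have := is_derive_add (is_derive_id x (1 : R)) (is_derive_const (- r) x); rewrite addr0.
have h2 : is_derive x 1 (fun y => (y - r) ^+ n.+1) (n.+1%:R * (x - r) ^+ n).
  have := is_deriveX n.+1 h1; rewrite /GRing.scale /= mulr1 mulr_natl.
  have -> // : ((fun y : R => y - r) ^+ n.+1 : R -> R) = (fun y => (y - r) ^+ n.+1).
  by apply/funext => y; elim: n.+1 => [|k IH]; rewrite ?expr0 // !exprS -IH.
have := is_derive_scale (n.+1`!%:R^-1) h2.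
have -> : n.+1`!%:R^-1 * (n.+1%:R * (x - r) ^+ n) = (x - r) ^+ n / n`!%:R :> R.
  rewrite factS natrM; field; rewrite pnatr_eq0 -lt0n fact_gt0 /=.
  by rewrite addrC natr1 pnatr_eq0.
by under eq_fun do rewrite mulrC.
Qed.

(* If all derivatives vanish at r, Taylor's formula forces p to vanish on [r, +oo). *)
Lemma order_exists p r x1 : tower p -> r < x1 -> p 0%N x1 != 0 ->
  (exists A B : R, [/\ 0 <= A, 0 <= B &
    forall k x, r <= x <= x1 -> `|p k x| <= A * B ^+ k]) ->
  exists n, order_at p r n.
Proof.
move=> hp rx1 px1 [A [B [A0 B0 bnd]]].
have [[n pn]|all0] := pselect (exists n, p n r != 0).
  have ex : exists n, p n r != 0 by exists n.
  exists (ex_minn ex); case: ex_minnP => k pk kmin; split => // j jk.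
  by apply/eqP/negP => /negP /kmin; rewrite leqNgt jk.
have {}all0 n : p n r = 0.
  by apply/eqP/negP => /negP h; apply: all0; exists n.
(* [j] integrations from [r] gain the factor (x - r)^j / j!. The order [k] stays general because
   each integration appeals to the next derivative. *)
have step j k x : r <= x <= x1 ->
    `|p k x| <= A * B ^+ (k + j) * ((x - r) ^+ j / j`!%:R).
  elim: j k x => [|j IH] k x xr.
    by rewrite addn0 expr0 fact0 divr1 mulr1; exact: bnd.
  move/andP: (xr) => [h1 h2].
  have := @norm_le_of_derive R (p k)
    (fun y => A * B ^+ (k + j.+1) * ((y - r) ^+ j.+1 / j.+1`!%:R)) (p k.+1)
    (fun y => A * B ^+ (k + j.+1) * ((y - r) ^+ j / j`!%:R)) r x h1.
  rewrite all0 subr0 subrr expr0n /= mul0r mulr0 subr0; apply.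
  - by move=> y _; exact: hp.
  - by move=> y _; apply: is_derive_scale; exact: is_derive_expn_fact.
  move=> y /andP[h3 h4]; rewrite -addSnnS; apply: IH; rewrite h3 /=.
  exact: le_trans h2.
exfalso; move/negP: px1; apply.
have x1r : r <= x1 <= x1 by rewrite lexx ltW.
(* At [k = 0] the bound is a multiple of the general term of an exponential series, so it tends to 0
   with [j]. *)
have c0 : (fun j => A * exp_coeff (B * (x1 - r)) j) @ \oo --> A * 0.
  apply: cvgMr; apply: cvg_series_cvg_0; exact: is_cvg_series_exp_coeff.
rewrite -normr_eq0; apply/eqP/le_anti; rewrite normr_ge0 andbT.
rewrite mulr0 in c0; rewrite -(cvg_lim _ c0) //.
apply: limr_ge; first by apply/cvg_ex; exists 0.
apply: nearW => j; have := step j 0%N x1 x1r.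
by rewrite add0n /exp_coeff /= exprMn !mulrA.
Qed.

(** * Finiteness and parity of the zeros on an interval *)

Section Count.
Variables (p : nat -> R -> R) (m : R -> nat).
Hypotheses (hp : tower p) (hm : forall x, order_at p x (m x)).

(** Finiteness of the zero set and the parity of the sign change are kept together because both
    survive concatenation of intervals. The strict inequality also keeps zeros away from the two
    ends. *)
Definition good x y := x < y /\ exists s : seq R,
  [/\ uniq s, forall z, z \in s <-> x < z < y /\ p 0%N z = 0 &
      0 < (-1) ^+ (\sum_(z <- s) m z)%N * (p 0%N x * p 0%N y)].

(** In the product of the two sign conditions the common end contributes the factor [p 0 y ^+ 2],
    which is positive because [y] is not a zero. *)
Lemma good_cat x y z : good x y -> good y z -> good x z.
Proof.
move=> [xy [s [us hs ss]]] [yz [t [ut ht st]]]; split; first exact: lt_trans yz.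
have py : p 0%N y != 0.
  by apply/eqP => E; move: ss; rewrite E !mulr0 ltxx.
exists (s ++ t); split.
- rewrite cat_uniq us ut andbT /=; apply/hasPn => w /ht[/andP[w1 _] _].
  by apply/negP => /hs[/andP[_ w2] _]; move: (lt_trans w1 w2); rewrite ltxx.
- move=> w; rewrite mem_cat; split.
    move=> /orP[/hs[/andP[w1 w2] pw]|/ht[/andP[w1 w2] pw]]; split => //.
      by rewrite w1 (lt_trans w2).
    by rewrite w2 (lt_trans xy).
  move=> [/andP[w1 w2] pw]; apply/orP.
  have [wy|wy|wy] := ltgtP w y.
  + by left; apply/hs; rewrite w1 wy.
  + by right; apply/ht; rewrite w2 wy.
  + by move: py; rewrite -wy pw eqxx.
- rewrite big_cat /= exprD; set e1 := _ ^+ _ in ss *; set e2 := _ ^+ _ in st *.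
  have : 0 < (e1 * (p 0%N x * p 0%N y)) * (e2 * (p 0%N y * p 0%N z)) by exact: mulr_gt0.
  have -> : (e1 * (p 0%N x * p 0%N y)) * (e2 * (p 0%N y * p 0%N z)) =
    (e1 * e2 * (p 0%N x * p 0%N z)) * (p 0%N y) ^+ 2 by ring.
  by rewrite pmulr_lgt0 // lt_def sqr_ge0 sqrf_eq0 py.
Qed.

Lemma good_local r : exists2 d, 0 < d & forall x y,
  r - d < x < r -> r < y < r + d -> good x y.
Proof.
have [d d0 hd] := tower_sign hp (hm r).
exists d => // x y hx hy; split.
  by move/andP: hx => [_ h]; move/andP: hy => [+ _]; exact: lt_trans.
have nzl z : r - d < z < r -> p 0%N z != 0.
  by move=> hz; apply/eqP => E; have := hd z y hz hy; rewrite E mul0r mulr0 ltxx.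
have nzr z : r < z < r + d -> p 0%N z != 0.
  by move=> hz; apply/eqP => E; have := hd x z hx hz; rewrite E !mulr0 ltxx.
move/andP: (hx) => [x1 x2]; move/andP: (hy) => [y1 y2].
have only z : x < z < y -> p 0%N z = 0 -> z = r.
  move=> /andP[z1 z2] /eqP pz; have [h|h|//] := ltgtP z r.
    by move: pz; rewrite (negPf (nzl z _)) // h (lt_trans x1).
  by move: pz; rewrite (negPf (nzr z _)) // h (lt_trans z2).
have [pr|pr] := eqVneq (p 0%N r) 0.
  exists [:: r]; split => // [z|]; last by rewrite big_seq1; exact: hd.
  rewrite inE; split => [/eqP ->|[h1 h2]]; first by rewrite x2 y1.
  by apply/eqP; exact: only.
exists [::]; split => // [z|].
  by split => // -[h1 h2]; move: pr; rewrite -(only z h1 h2) h2 eqxx.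
rewrite big_nil; have := hd x y hx hy; suff -> : m r = 0%N by [].
by have [h _] := hm r; case E : (m r) h => [//|k] h; move: pr; rewrite h // eqxx.
Qed.

(** [good_local] puts [r] strictly inside the interval; this variant starts at [r] itself and serves
    when the supremum in [good_exists] is attained. *)
Lemma good_right r : p 0%N r != 0 ->
  exists2 d, 0 < d & forall y, r < y < r + d -> good r y.
Proof.
move=> pr.
have c : {for r, continuous (fun x => p 0%N r * p 0%N x)}.
  by apply: cvgMr; exact: tower_continuous hp _.
have pos : 0 < p 0%N r * p 0%N r by rewrite -expr2 lt_def sqr_ge0 sqrf_eq0 pr.
have /cvgrPdist_lt/(_ _ pos)/nbhs_ballP[d /= d0 hd] := c.
exists d => // y /andP[y1 y2]; split => //.
have key z : r <= z < r + d -> 0 < p 0%N r * p 0%N z.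
  move=> /andP[z1 z2]; have /hd /= : ball r d z.
    by rewrite /ball /= ltr_norml; apply/andP; split; lra.
  by rewrite ltr_norml => /andP[_]; lra.
exists [::]; split => // [z|]; last by rewrite big_nil mul1r key // y2 ltW.
split => // -[/andP[z1 z2] pz]; have := key z.
by rewrite pz mulr0 ltxx => H; apply: H; rewrite (ltW z1) (lt_trans z2).
Qed.

(** If no good interval from [x0] ended beyond [b], the right ends would have a supremum; a good
    interval around it, or starting at it, would reach further. *)
Lemma good_exists (a b e : R) : a <= b -> 0 < e ->
  exists x y, [/\ a - e < x < a, b < y & good x y].
Proof.
move=> ab e0; have [d d0 hd] := good_local a.
(* [good_local] at [a] needs a start strictly to the left of [a], within distance [d]; the minimum
   also keeps it within [e]. *)
pose x0 := a - Num.min e d / 2.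
have md : 0 < Num.min e d by rewrite lt_min e0.
have [me1 me2] : Num.min e d <= e /\ Num.min e d <= d.
  by rewrite !ge_min !lexx orbT.
exists x0; pose S := [set y | a < y /\ good x0 y].
have [[y [Sy yb]]|noS] := pselect (exists y, S y /\ b < y).
  by exists y; split => //; [apply/andP; split; rewrite /x0; lra|case: Sy].
exfalso.
have ubS : ubound S b.
  by move=> y Sy; rewrite leNgt; apply/negP => h; apply: noS; exists y.
have S1 : S (a + d / 2).
  by split; [lra|apply: hd; apply/andP; split; rewrite /x0; lra].
have supS : has_sup S by split; [exists (a + d / 2)|exists b].
set sg := sup S.
have Sle y : S y -> y <= sg by move=> Sy; exact: (ub_le_sup supS.2).
have [d' d'0 hd'] := good_local sg.
have [y Sy ysg] := sup_adherent d'0 supS; rewrite -/sg in ysg.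
have asg : a < sg by apply: lt_le_trans (Sle _ S1); lra.
have extend y1 : sg < y1 -> good x0 y1 -> False.
  move=> h g; suff /Sle : S y1 by rewrite leNgt h.
  by split => //; exact: lt_trans h.
have [ysg'|ysg'] := eqVneq y sg.
  have ny : p 0%N sg != 0.
    case: Sy => _ [_ [s [_ _ H]]]; apply/eqP => E.
    by move: H; rewrite ysg' E !mulr0 ltxx.
  have [d2 d20 hd2] := good_right ny.
  apply: (extend (sg + d2 / 2)); first lra.
  apply: (@good_cat _ sg); first by rewrite -ysg'; case: Sy.
  by apply: hd2; apply/andP; split; lra.
have ylt : y < sg by rewrite lt_neqAle ysg' Sle.
apply: (extend (sg + d' / 2)); first lra.
apply: (@good_cat _ y); first by case: Sy.
by apply: hd'; apply/andP; split; lra.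
Qed.

(* Sign changes are exactly the zeros of odd order. *)
Lemma odd_zero_count (a b : R) : 0 < a -> a <= b ->
  (forall x, 0 < x <= a -> 0 < p 0%N x) -> (forall x, b <= x -> p 0%N x < 0) ->
  exists s : seq R, [/\ uniq s, forall z, z \in s <-> 0 < z /\ p 0%N z = 0 &
    odd (\sum_(z <- s) m z)%N].
Proof.
move=> a0 ab pos neg.
(* Taking [e = a] gives 0 < x < a, so that no positive zero is lost to the left of [x]. *)
have [x [y [/andP[x1 x2] yb [xy [s [us hs ss]]]]]] := good_exists ab a0.
have x0 : 0 < x by move: x1; rewrite subrr.
have px : 0 < p 0%N x by apply: pos; rewrite x0 ltW.
have py : p 0%N y < 0 by apply: neg; exact: ltW.
exists s; split => // [z|].
  split => [/hs[/andP[z1 z2] pz]|[z0 pz]]; first by split => //; exact: lt_trans z1.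
  apply/hs; split => //; apply/andP; split.
    rewrite ltNge; apply/negP => h; have : 0 < p 0%N z.
      by apply: pos; rewrite z0 (le_trans h) // ltW.
    by rewrite pz ltxx.
  rewrite ltNge; apply/negP => h; have : p 0%N z < 0.
    by apply: neg; apply: ltW; exact: lt_le_trans h.
  by rewrite pz ltxx.
move: ss; rewrite -signr_odd; case: odd => //.
by rewrite expr0 mul1r pmulr_rgt0 // => /lt_trans /(_ py); rewrite ltxx.
Qed.

End Count.
End Tower.

(** * Entire functions of exponential type *)

(** A quadratic remainder makes the error of the difference quotient at most C |t|. The field is
    arbitrary because the statement is applied over the complex numbers and, for the restriction to
    the real axis, over [R]. The radius e / (C + 1 + e) is at most 1, and C times it is at most
    e. *)
Lemma derive1_quadratic (K : numFieldType) (h : K -> K^o) (z l C : K) : 0 <= C ->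
  (forall t, `|t| <= 1 -> `|h (t + z) - h z - t * l| <= C * `|t| ^+ 2) ->
  (fun t => t^-1 *: (h (t + z) - h z)) t @[t --> 0^'] --> (l : K^o).
Proof.
move=> C0 H; apply/cvgrPdist_le => e e0.
have d0 : 0 < e / (C + 1 + e) by rewrite divr_gt0 // addr_gt0 // ltr_wpDl.
have C1 : 0 < C + 1 + e by rewrite addr_gt0 // ltr_wpDl.
near=> t.
have t0 : t != 0 by near: t; exact: nbhs_dnbhs_neq.
have td : `|t| <= e / (C + 1 + e) by near: t; exact: dnbhs0_le.
have t1 : `|t| <= 1.
  by apply: le_trans td _; rewrite ler_pdivrMr // mul1r lerDr addr_ge0.
have -> : l - t^-1 *: (h (t + z) - h z) = - t^-1 * (h (t + z) - h z - t * l).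
  by rewrite /GRing.scale /=; field.
rewrite normrM normrN normfV ler_pdivrMl ?normr_gt0 //.
apply: le_trans (H t t1) _; rewrite expr2 mulrA mulrC ler_pM2l ?normr_gt0 //.
apply: (@le_trans _ _ (C * (e / (C + 1 + e)))); first exact: ler_wpM2l.
rewrite mulrA ler_pdivrMr // mulrC ler_pM2l //.
by rewrite -addrA lerDl addr_ge0 // ltW.
Unshelve. all: by end_near. Qed.

(** * Power series with real coefficients and complex argument *)

Section Series.
Context {R : realType}.
Local Notation C := R[i].
Local Notation Re := complex.Re.
Local Notation Im := complex.Im.
Local Notation nm := (@Normc.normc R).
Implicit Types (c : nat -> C) (l z t : C) (w : nat -> R).

Lemma ReD (x y : C) : Re (x + y) = Re x + Re y. Proof. by case: x; case: y. Qed.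
Lemma ImD (x y : C) : Im (x + y) = Im x + Im y. Proof. by case: x; case: y. Qed.
Lemma ReN (x : C) : Re (- x) = - Re x. Proof. by case: x. Qed.
Lemma ImN (x : C) : Im (- x) = - Im x. Proof. by case: x. Qed.
Lemma ReM (x y : C) : Re (x * y) = Re x * Re y - Im x * Im y.
Proof. by case: x; case: y. Qed.
Lemma ImM (x y : C) : Im (x * y) = Re x * Im y + Im x * Re y.
Proof. by case: x => a b; case: y => a' b' /=; rewrite addrC [b * _]mulrC [a * _]mulrC. Qed.
Lemma Re_sum (I : Type) (r : seq I) (P : pred I) (F : I -> C) :
  Re (\sum_(i <- r | P i) F i) = \sum_(i <- r | P i) Re (F i).
Proof. by elim/big_rec2 : _ => // i x y _ <-; rewrite ReD. Qed.
Lemma Im_sum (I : Type) (r : seq I) (P : pred I) (F : I -> C) :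
  Im (\sum_(i <- r | P i) F i) = \sum_(i <- r | P i) Im (F i).
Proof. by elim/big_rec2 : _ => // i x y _ <-; rewrite ImD. Qed.
Lemma complex_ext (x y : C) : Re x = Re y -> Im x = Im y -> x = y.
Proof. by case: x; case: y => a b a' b' /= -> ->. Qed.

Lemma normr_nm z : `|z| = (nm z)%:C. Proof. by []. Qed.
Lemma nm_ge0 z : 0 <= nm z.
Proof. by have := normr_ge0 z; rewrite normr_nm ler0c. Qed.
Lemma Re_le_nm z : `|Re z| <= nm z.
Proof. by rewrite -lecR; exact: normc_ge_Re. Qed.
Lemma Im_le_nm z : `|Im z| <= nm z.
Proof.
rewrite -normrN -ReiNIm; apply: le_trans (Re_le_nm _) _.
by rewrite Normc.normcM /= expr0n /= add0r expr1n sqrtr1 mulr1.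
Qed.
Lemma nm_le z : nm z <= `|Re z| + `|Im z|.
Proof.
rewrite {1}[z]complexE; apply: le_trans (le_normcD _ _) _; apply: lerD.
  by rewrite /= expr0n /= addr0 sqrtr_sqr.
by rewrite Normc.normcM /= !expr0n /= add0r addr0 expr1n sqrtr1 mul1r sqrtr_sqr.
Qed.
Lemma nmX z n : nm (z ^+ n) = nm z ^+ n.
Proof.
elim: n => [|n IH]; last by rewrite !exprS Normc.normcM IH.
by rewrite !expr0 Normc.normc1.
Qed.
Lemma nm_real (x : R) : nm x%:C = `|x|.
Proof. by rewrite /= expr0n /= addr0 sqrtr_sqr. Qed.

(** Convergence is expressed on real and imaginary parts, so that all limits are taken in [R]. *)
Definition sums_to c l :=
  (fun N => Re (\sum_(0 <= n < N) c n)) @ \oo --> Re l /\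
  (fun N => Im (\sum_(0 <= n < N) c n)) @ \oo --> Im l.

Lemma sums_to_unique c l l' : sums_to c l -> sums_to c l' -> l = l'.
Proof.
by move=> [h1 h2] [h1' h2']; apply: complex_ext;
  [rewrite -(cvg_lim _ h1) // -(cvg_lim _ h1')|rewrite -(cvg_lim _ h2) // -(cvg_lim _ h2')].
Qed.

Lemma sums_toD c c' l l' : sums_to c l -> sums_to c' l' ->
  sums_to (fun n => c n + c' n) (l + l').
Proof.
move=> [h1 h2] [h1' h2']; split; rewrite ?ReD ?ImD;
  under eq_fun do rewrite big_split /= ?ReD ?ImD; exact: cvgD.
Qed.

Lemma sums_toM z c l : sums_to c l -> sums_to (fun n => z * c n) (z * l).
Proof.
move=> [h1 h2]; split.
  rewrite ReM; under eq_fun do rewrite -mulr_sumr ReM.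
  by apply: cvgB; exact: cvgMl_tmp.
rewrite ImM; under eq_fun do rewrite -mulr_sumr ImM.
by apply: cvgD; exact: cvgMl_tmp.
Qed.

Lemma sums_to_shift c l : c 0%N = 0 -> sums_to (fun n => c n.+1) l -> sums_to c l.
Proof.
move=> c0 [h1 h2]; split; rewrite -cvg_shiftS /=.
  by under eq_fun do rewrite big_nat_recl // c0 add0r.
by under eq_fun do rewrite big_nat_recl // c0 add0r.
Qed.

Lemma series_le (u : nat -> R) (A x : R) : 0 <= A -> 0 <= x ->
  (forall n, `|u n| <= A * x ^+ n / n`!%:R) ->
  exists2 l, (fun N => \sum_(0 <= n < N) u n) @ \oo --> l & `|l| <= A * expR x.
Proof.
move=> A0 x0 hu; pose w n := A * exp_coeff x n.
have cw : series w @ \oo --> A * expR x.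
  have -> : series w = fun N => A * series (exp_coeff x) N.
    by apply/funext => N; rewrite /series /= mulr_sumr.
  by apply: cvgMl_tmp; exact: is_cvg_series_exp_coeff.
have uw n : `|u n| <= w n by rewrite /w /exp_coeff /= mulrA; exact: hu.
have cn : cvgn [normed series u].
  apply: (series_le_cvg _ _ uw) => [n|n|] //; first exact: le_trans (uw n).
  by apply/cvg_ex; exists (A * expR x).
exists (limn (series u)); first by have := normed_cvg cn.
apply: le_trans (lim_series_norm cn) _.
rewrite -(cvg_lim _ cw) //; apply: lim_series_le => //.
by apply/cvg_ex; exists (A * expR x).
Qed.

Lemma sums_to_exists c (A x : R) : 0 <= A -> 0 <= x ->
  (forall n, nm (c n) <= A * x ^+ n / n`!%:R) ->
  exists2 l, sums_to c l & `|Re l| <= A * expR x /\ `|Im l| <= A * expR x.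
Proof.
move=> A0 x0 hc.
have [a ha a1] := @series_le (fun n => Re (c n)) A x A0 x0
  (fun n => le_trans (Re_le_nm _) (hc n)).
have [b hb b1] := @series_le (fun n => Im (c n)) A x A0 x0
  (fun n => le_trans (Im_le_nm _) (hc n)).
exists (a +i* b) => //; split.
  by under eq_fun do rewrite Re_sum.
by under eq_fun do rewrite Im_sum.
Qed.

(** This is the coefficient form of the growth bound A exp(B |z|). Differentiation preserves [B] and
    multiplies [A] by [B], which bounds all derivatives geometrically on compact sets, as
    [order_exists] requires. *)
Definition exp_type (a : nat -> R) (A B : R) :=
  [/\ 0 <= A, 0 <= B & forall n, `|a n| <= A * B ^+ n / n`!%:R].

(* The value is 0 where the series diverges. *)
Definition psum (a : nat -> R) (z : C) : C :=
  xget 0 [set l | sums_to (fun n => (a n)%:C * z ^+ n) l].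

Lemma exp_type_term a A B z n : exp_type a A B ->
  nm ((a n)%:C * z ^+ n) <= A * (B * nm z) ^+ n / n`!%:R.
Proof.
move=> [A0 B0 ha]; rewrite Normc.normcM nm_real nmX exprMn.
rewrite [A * _]mulrA mulrAC; apply: ler_wpM2r; last exact: ha.
by rewrite exprn_ge0 // nm_ge0.
Qed.

Lemma psumP a A B z : exp_type a A B ->
  sums_to (fun n => (a n)%:C * z ^+ n) (psum a z) /\
  `|Re (psum a z)| <= A * expR (B * nm z).
Proof.
move=> ha; have [A0 B0 _] := ha.
have x0 : 0 <= B * nm z by rewrite mulr_ge0 // nm_ge0.
have [l hl [l1 _]] := sums_to_exists A0 x0 (fun n => exp_type_term z n ha).
have H : sums_to (fun n => (a n)%:C * z ^+ n) (psum a z).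
  by rewrite /psum; case: xgetP => [y -> //|/(_ l)]; case.
by split => //; rewrite (sums_to_unique H hl).
Qed.

Lemma psum_unique a A B z l : exp_type a A B ->
  sums_to (fun n => (a n)%:C * z ^+ n) l -> l = psum a z.
Proof. by move=> ha hl; apply: sums_to_unique hl _; have [] := psumP z ha. Qed.

Lemma psum_real a A B (x : R) : exp_type a A B ->
  psum a x%:C = (Re (psum a x%:C))%:C.
Proof.
move=> ha; have [[_ h] _] := psumP x%:C ha; apply: complex_ext => //=.
rewrite -(cvg_lim _ h) // -[RHS](@lim_cst R _ _ \oo) //; congr (lim _).
rewrite (_ : (fun N => _) = cst 0) //; apply/funext => N.
rewrite Im_sum big1 // => n _.
by rewrite -rmorphXn -rmorphM.
Qed.

Lemma psum0 a A B : exp_type a A B -> psum a 0 = (a 0%N)%:C.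
Proof.
move=> ha; apply/esym; apply: psum_unique ha _.
have E N : \sum_(0 <= n < N.+1) (a n)%:C * 0 ^+ n = (a 0%N)%:C :> C.
  rewrite big_nat_recl // expr0 mulr1 big1 ?addr0 // => n _.
  by rewrite expr0n /= mulr0.
by split; rewrite -cvg_shiftS /=; under eq_fun do rewrite E; exact: cvg_cst.
Qed.

Definition dcoef (a : nat -> R) n : R := n.+1%:R * a n.+1.

Lemma exp_type_dcoef a A B : exp_type a A B -> exp_type (dcoef a) (A * B) B.
Proof.
move=> [A0 B0 ha]; split => // [|n]; first exact: mulr_ge0.
rewrite /dcoef normrM ger0_norm ?ler0n //.
apply: le_trans (ler_wpM2l _ (ha n.+1)) _; first exact: ler0n.
have f0 : n`!%:R != 0 :> R by rewrite pnatr_eq0 -lt0n fact_gt0.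
have n0 : n.+1%:R != 0 :> R by rewrite pnatr_eq0.
rewrite factS natrM exprS le_eqVlt; apply/orP; left; apply/eqP; field.
by rewrite f0 /= addrC natr1.
Qed.

Lemma exp_type_iter a A B k : exp_type a A B -> exp_type (iter k dcoef a) (A * B ^+ k) B.
Proof.
move=> ha; elim: k => [|k IH]; first by rewrite expr0 mulr1.
by rewrite exprSr mulrA; exact: exp_type_dcoef.
Qed.

(** Multiplying by t + z turns the remainder at n into the one at n + 1, up to the term t^2 n
    z^(n-1). The crude factor n^2 leaves room for it; at n = 0 the truncated exponent is harmless
    because its coefficient is 0. *)
Lemma binomial_remainder z t n (r : R) : nm z + 1 <= r -> nm t <= 1 ->
  nm ((t + z) ^+ n - z ^+ n - t * (n%:R * z ^+ n.-1)) <= n%:R ^+ 2 * nm t ^+ 2 * r ^+ n.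
Proof.
move=> zr t1; have z0 := nm_ge0 z; have t0 := nm_ge0 t.
have r1 : 1 <= r by lra.
have r0 : 0 <= r by lra.
elim: n => [|n IH].
  by rewrite !expr0 mul0r mulr0 subrr subr0 Normc.normc0 expr0n /= !mul0r.
have -> : (t + z) ^+ n.+1 - z ^+ n.+1 - t * (n.+1%:R * z ^+ n) =
    (t + z) * ((t + z) ^+ n - z ^+ n - t * (n%:R * z ^+ n.-1)) +
    t ^+ 2 * (n%:R * z ^+ n.-1).
  case: n {IH} => [|n] /=; first by rewrite !expr0 !expr1; ring.
  by rewrite !exprS -natr1; ring.
apply: le_trans (le_normcD _ _) _; rewrite [X in X + _]Normc.normcM.
have tz : nm (t + z) <= r by apply: le_trans (le_normcD _ _) _; lra.
have h1 : nm (t + z) * nm ((t + z) ^+ n - z ^+ n - t * (n%:R * z ^+ n.-1)) <=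
    r * (n%:R ^+ 2 * nm t ^+ 2 * r ^+ n).
  by apply: ler_pM => //; exact: nm_ge0.
have zn : nm (n%:R * z ^+ n.-1) <= n%:R * r ^+ n.+1.
  rewrite Normc.normcM nmX -[n%:R](rmorph_nat (real_complex R)) nm_real ger0_norm ?ler0n //.
  apply: ler_wpM2l; first exact: ler0n.
  apply: (@le_trans _ _ (r ^+ n.-1)); first by apply: lerXn2r; rewrite ?nnegrE //; lra.
  by apply: ler_weXn2l => //; case: n {IH h1} => // n; exact: leq_trans (leq_pred _) _.
have h2 : nm (t ^+ 2) * nm (n%:R * z ^+ n.-1) <= nm t ^+ 2 * (n%:R * r ^+ n.+1).
  by rewrite nmX; apply: ler_wpM2l => //; rewrite exprn_ge0.
rewrite -Normc.normcM in h2.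
have -> : n.+1%:R ^+ 2 * nm t ^+ 2 * r ^+ n.+1 =
    r * (n%:R ^+ 2 * nm t ^+ 2 * r ^+ n) + nm t ^+ 2 * (n%:R * r ^+ n.+1)
    + nm t ^+ 2 * (n%:R + 1) * r ^+ n.+1 :> R.
  by rewrite -natr1 [r ^+ n.+1]exprS; ring.
rewrite -[X in X <= _]addr0; apply: lerD; last first.
  by rewrite !mulr_ge0 ?exprn_ge0 // addr_ge0.
exact: lerD.
Qed.

Lemma psum_expansion a A B z t : exp_type a A B -> nm t <= 1 ->
  nm (psum a (t + z) - psum a z - t * psum (dcoef a) z) <=
  2 * (A * expR (B * 4 * (nm z + 1))) * nm t ^+ 2.
Proof.
move=> ha t1; have [A0 B0 hb] := ha.
set r := nm z + 1; have r0 : 0 <= r by rewrite addr_ge0 // nm_ge0.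
pose c n := (a n)%:C * ((t + z) ^+ n - z ^+ n - t * (n%:R * z ^+ n.-1)).
have [h1 _] := psumP (t + z) ha; have [h2 _] := psumP z ha.
have [h3 _] := psumP z (exp_type_dcoef ha).
have h4 : sums_to (fun n => t * ((a n)%:C * (n%:R * z ^+ n.-1))) (t * psum (dcoef a) z).
  apply: sums_toM; apply: sums_to_shift; first by rewrite mul0r mulr0.
  have -> // : (fun n => (a n.+1)%:C * (n.+1%:R * z ^+ n)) =
    (fun n => (dcoef a n)%:C * z ^+ n).
  by apply/funext => n; rewrite /dcoef rmorphM rmorph_nat mulrCA mulrA.
have hc : sums_to c (psum a (t + z) - psum a z - t * psum (dcoef a) z).
  have := sums_toD (sums_toD h1 (sums_toM (-1) h2)) (sums_toM (-1) h4).
  rewrite !mulN1r; congr (sums_to _ _); apply/funext => n; rewrite /c; ring.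
have x0 : 0 <= B * 4 * r by rewrite !mulr_ge0.
have bc n : nm (c n) <= A * nm t ^+ 2 * (B * 4 * r) ^+ n / n`!%:R.
  rewrite /c Normc.normcM nm_real.
  apply: (@le_trans _ _ (A * B ^+ n / n`!%:R * (n%:R ^+ 2 * nm t ^+ 2 * r ^+ n))).
    by apply: ler_pM => //; [exact: nm_ge0|exact: binomial_remainder].
  (* This absorbs the n^2 of the binomial remainder and is the source of the 4 in the exponent; the
     leading 2 of the bound comes from adding real and imaginary parts. *)
  have n4 : n%:R ^+ 2 <= 4 ^+ n :> R.
    have -> : 4 = 2 ^+ 2 :> R by ring.
    rewrite -exprM mulnC exprM -!natrX ler_nat leq_sqr; exact: ltnW (ltn_expl n (ltnSn 1)).
  have -> : A * B ^+ n / n`!%:R * (n%:R ^+ 2 * nm t ^+ 2 * r ^+ n) =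
    (A * nm t ^+ 2 * (B ^+ n * r ^+ n) / n`!%:R) * n%:R ^+ 2 by ring.
  have -> : A * nm t ^+ 2 * (B * 4 * r) ^+ n / n`!%:R =
    (A * nm t ^+ 2 * (B ^+ n * r ^+ n) / n`!%:R) * 4 ^+ n by rewrite !exprMn; ring.
  apply: ler_wpM2l => //.
  by rewrite !mulr_ge0 ?exprn_ge0 ?invr_ge0 // nm_ge0.
have A1 : 0 <= A * nm t ^+ 2 by rewrite mulr_ge0 // exprn_ge0 // nm_ge0.
have [l hl [l1 l2]] := sums_to_exists A1 x0 bc.
rewrite (sums_to_unique hc hl); apply: le_trans (nm_le _) _.
by apply: le_trans (lerD l1 l2) _; lra.
Qed.

Lemma derive1_psum a A B : exp_type a A B ->
  derive1 (psum a : C -> C^o) = psum (dcoef a).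
Proof.
move=> ha; have [A0 B0 _] := ha; apply/funext => z; apply: cvg_lim => //.
apply: (@derive1_quadratic _ (psum a : C -> C^o) z _
  (2 * (A * expR (B * 4 * (nm z + 1))))%:C).
  by rewrite lecR !mulr_ge0 // expR_ge0.
move=> t; rewrite !normr_nm -rmorphXn -rmorphM !lecR => t1.
exact: psum_expansion.
Qed.

Lemma complex_derive1n_psum a A B k : exp_type a A B ->
  complex_derive1n k (psum a) = psum (iter k dcoef a).
Proof.
move=> ha; elim: k => [|k IH] //.
rewrite /complex_derive1n derive1nS -/(complex_derive1n k (psum a)) IH iterS.
exact: derive1_psum (exp_type_iter k ha).
Qed.

Lemma is_derive_psum_real a A B (x : R) : exp_type a A B ->
  is_derive x 1 (fun y : R => Re (psum a y%:C)) (Re (psum (dcoef a) x%:C)).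
Proof.
move=> ha; have [A0 B0 _] := ha.
have H := @derive1_quadratic R (fun y : R => Re (psum a y%:C)) x
  (Re (psum (dcoef a) x%:C)) (2 * (A * expR (B * 4 * (nm x%:C + 1)))).
have {}H : (fun t : R => t^-1 *: (Re (psum a (t + x)%:C) - Re (psum a x%:C))) t @[t --> 0^']
    --> Re (psum (dcoef a) x%:C).
  apply: H; first by rewrite !mulr_ge0 // expR_ge0.
  move=> t t1; have := @psum_expansion a A B x%:C t%:C ha.
  rewrite !nm_real => /(_ t1); apply: le_trans.
  apply: le_trans (Re_le_nm _); rewrite rmorphD !ReD !ReN ReM /=.
  by rewrite mul0r subr0.
have E : (fun h : R => h^-1 *: (Re (psum a (h *: (1 : R) + x)%:C) - Re (psum a x%:C))) =
    (fun t : R => t^-1 *: (Re (psum a (t + x)%:C) - Re (psum a x%:C))).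
  by apply/funext => h; rewrite /GRing.scale /= mulr1.
apply: DeriveDef.
  by apply/cvg_ex; exists (Re (psum (dcoef a) x%:C)); rewrite /= E.
by rewrite /derive E; exact: cvg_lim.
Qed.

Lemma psum_tower a A B : exp_type a A B ->
  tower (fun k x => Re (psum (iter k dcoef a) x%:C)).
Proof. by move=> ha k x; exact: is_derive_psum_real (exp_type_iter k ha). Qed.

End Series.

(** * Complex linear differential systems *)

Section ComplexODE.
Context {R : realType}.
Local Notation C := R[i].
Local Notation Re := complex.Re.
Local Notation Im := complex.Im.
Local Notation nm := (@Normc.normc R).
Implicit Types (f g df dg : R -> C) (x : R).

Definition cdiff f df := forall x,
  is_derive x 1 (fun y : R => Re (f y)) (Re (df x)) /\
  is_derive x 1 (fun y : R => Im (f y)) (Im (df x)).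

Lemma cdiffP f df : cdiff f df <-> cderivable f /\ forall x, cderive f x = df x.
Proof.
split=> [h|[h1 h2] x].
  split=> x; have [[h1 h2] [h3 h4]] := h x; first by split.
  by rewrite /cderive !derive1E h2 h4; case: (df x).
have [d1 d2] := h1 x; rewrite -h2 /cderive !derive1E.
by split; apply: derivableP.
Qed.

Lemma cdiff_ext f df dg : cdiff f df -> df =1 dg -> cdiff f dg.
Proof. by move=> h e x; rewrite -e; exact: h. Qed.

Lemma cdiff_cst (z : C) : cdiff (fun=> z) (fun=> 0).
Proof. by move=> x; split; exact: is_derive_const. Qed.

Lemma cdiffD f g df dg : cdiff f df -> cdiff g dg ->
  cdiff (fun x => f x + g x) (fun x => df x + dg x).
Proof.
move=> hf hg x; have [f1 f2] := hf x; have [g1 g2] := hg x.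
by rewrite ReD ImD; split; [under eq_fun do rewrite ReD|under eq_fun do rewrite ImD];
  exact: is_derive_add.
Qed.

Lemma cdiffM f g df dg : cdiff f df -> cdiff g dg ->
  cdiff (fun x => f x * g x) (fun x => df x * g x + f x * dg x).
Proof.
move=> hf hg x; have [f1 f2] := hf x; have [g1 g2] := hg x.
rewrite ReD ImD !ReM !ImM; split.
  under eq_fun do rewrite ReM.
  have -> : Re (df x) * Re (g x) - Im (df x) * Im (g x) +
    (Re (f x) * Re (dg x) - Im (f x) * Im (dg x)) =
    (Re (df x) * Re (g x) + Re (f x) * Re (dg x)) +
    - (Im (df x) * Im (g x) + Im (f x) * Im (dg x)) by ring.
  exact: (is_derive_add (is_derive_mul f1 g1) (is_derive_opp (is_derive_mul f2 g2))).
under eq_fun do rewrite ImM.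
have -> : Re (df x) * Im (g x) + Im (df x) * Re (g x) +
    (Re (f x) * Im (dg x) + Im (f x) * Re (dg x)) =
    (Re (df x) * Im (g x) + Re (f x) * Im (dg x)) +
    (Im (df x) * Re (g x) + Im (f x) * Re (dg x)) by ring.
exact: (is_derive_add (is_derive_mul f1 g2) (is_derive_mul f2 g1)).
Qed.

Lemma cdiffZ (z : C) f df : cdiff f df -> cdiff (fun x => z * f x) (fun x => z * df x).
Proof.
move=> h; apply: cdiff_ext; first exact: cdiffM (cdiff_cst z) h.
by move=> x /=; rewrite mul0r add0r.
Qed.

Lemma cdiffN f df : cdiff f df -> cdiff (fun x => - f x) (fun x => - df x).
Proof.
move=> h; have := cdiffZ (-1) h.
by under eq_fun do rewrite mulN1r; under [X in cdiff _ X]eq_fun do rewrite mulN1r.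
Qed.

Lemma cdiff_sum (I : finType) (f df : I -> R -> C) :
  (forall i, cdiff (f i) (df i)) ->
  cdiff (fun x => \sum_i f i x) (fun x => \sum_i df i x).
Proof.
move=> h x; rewrite Re_sum Im_sum; split.
  under eq_fun do rewrite Re_sum.
  apply: (@is_derive_bigsum R I (fun i y => Re (f i y)) (fun i y => Re (df i y))).
  by move=> i; have [] := h i x.
under eq_fun do rewrite Im_sum.
apply: (@is_derive_bigsum R I (fun i y => Im (f i y)) (fun i y => Im (df i y))).
by move=> i; have [] := h i x.
Qed.

Lemma cdiff_affine f df (c e : R) : cdiff f df ->
  cdiff (fun x => f (c * x + e)) (fun x => c%:C * df (c * x + e)).
Proof.
move=> h x; have [h1 h2] := h (c * x + e).
rewrite ReM ImM /= mul0r subr0 mul0r addr0; split.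
  exact: (is_derive_affine h1).
exact: (is_derive_affine h2).
Qed.

Lemma cdiff_real (f df : R -> R) : (forall x, is_derive x 1 f (df x)) ->
  cdiff (fun x => (f x)%:C) (fun x => (df x)%:C).
Proof. by move=> h x; split => /=; [exact: h|exact: is_derive_const]. Qed.

Lemma cdiff_eq_cst f : cdiff f (fun=> 0) -> forall x, f x = f 0.
Proof.
move=> h x; apply: complex_ext.
  by apply: (@is_derive_0_is_cst _ (fun y : R => Re (f y))) => y; have [] := h y.
by apply: (@is_derive_0_is_cst _ (fun y : R => Im (f y))) => y; have [] := h y.
Qed.

Lemma cdiff_continuous f df : cdiff f df ->
  continuous (fun x : R => Re (f x)) /\ continuous (fun x : R => Im (f x)).
Proof.
by move=> h; split => x; have [h1 h2] := h x; apply: is_derive_continuous; eassumption.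
Qed.

Definition mdiff m n (Y dY : R -> 'M[C]_(m, n)) := forall i j,
  cdiff (fun x => Y x i j) (fun x => dY x i j).

Lemma mdiff_ext m n (Y dY Z dZ : R -> 'M[C]_(m, n)) : mdiff Y dY ->
  Y =1 Z -> dY =1 dZ -> mdiff Z dZ.
Proof. by move=> h /funext <- /funext <-. Qed.

Lemma mdiffD m n (Y dY Z dZ : R -> 'M[C]_(m, n)) : mdiff Y dY -> mdiff Z dZ ->
  mdiff (fun x => Y x + Z x) (fun x => dY x + dZ x).
Proof.
move=> h1 h2 i j; under eq_fun do rewrite mxE.
by apply: cdiff_ext; [exact: cdiffD (h1 i j) (h2 i j)|move=> x; rewrite mxE].
Qed.

Lemma mdiffZ m n (z : C) (Y dY : R -> 'M[C]_(m, n)) : mdiff Y dY ->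
  mdiff (fun x => z *: Y x) (fun x => z *: dY x).
Proof.
move=> h i j; under eq_fun do rewrite mxE.
by apply: cdiff_ext; [exact: cdiffZ (h i j)|move=> x; rewrite mxE].
Qed.

Lemma mdiff_mulr m n p (B : 'M[C]_(n, p)) (Y dY : R -> 'M[C]_(m, n)) : mdiff Y dY ->
  mdiff (fun x => Y x *m B) (fun x => dY x *m B).
Proof.
move=> h i j; under eq_fun do rewrite mxE.
apply: (@cdiff_ext _ (fun x => \sum_k dY x i k * B k j)); last by move=> x; rewrite mxE.
apply: (@cdiff_sum _ (fun k x => Y x i k * B k j) (fun k x => dY x i k * B k j)) => k.
apply: cdiff_ext; first exact: cdiffM (h i k) (cdiff_cst _).
by move=> x /=; rewrite mulr0 addr0.
Qed.

Lemma mdiff_mull m n p (B : 'M[C]_(p, m)) (Y dY : R -> 'M[C]_(m, n)) : mdiff Y dY ->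
  mdiff (fun x => B *m Y x) (fun x => B *m dY x).
Proof.
move=> h i j; under eq_fun do rewrite mxE.
apply: (@cdiff_ext _ (fun x => \sum_k B i k * dY x k j)); last by move=> x; rewrite mxE.
by apply: (@cdiff_sum _ (fun k x => B i k * Y x k j) (fun k x => B i k * dY x k j)) => k;
  apply: cdiffZ.
Qed.

(** [gronwall] is applied to the real and imaginary parts of all entries, whence the index type with
    a boolean. [G] is chosen before the system and the defect, so one constant serves a whole
    sequence of approximate solutions. *)
Lemma lin_bound m n (K b : R) : 0 <= K -> 0 <= b ->
  exists2 G : R, 0 <= G & forall (Y dY : R -> 'M[C]_(m, n)) (A : R -> 'M[C]_m) (d : R),
    0 <= d -> mdiff Y dY ->
    (forall x i j, 0 <= x <= b -> nm ((dY x - A x *m Y x) i j) <= d) ->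
    (forall x i j, 0 <= x <= b -> nm (A x i j) <= K) ->
    Y 0 = 0 -> forall x i j, 0 <= x <= b ->
    Re (Y x i j) ^+ 2 <= G * d ^+ 2 /\ Im (Y x i j) ^+ 2 <= G * d ^+ 2.
Proof.
move=> K0 b0.
pose I : finType := ('I_m * 'I_n * bool)%type; pose N : R := #|I|%:R.
exists (N * b * expR ((2 * K * N + 1) * b)).
  by rewrite !mulr_ge0 // ?expR_ge0 // ler0n.
move=> Y dY A d d0 hY hd hA Y0 x i j xb.
pose y (s : I) (t : R) := if s.2 then Re (Y t s.1.1 s.1.2) else Im (Y t s.1.1 s.1.2).
pose dy (s : I) (t : R) := if s.2 then Re (dY t s.1.1 s.1.2) else Im (dY t s.1.1 s.1.2).
have hy s (t : R) : 0 <= t <= b -> is_derive t 1 (y s) (dy s t).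
  by move=> _; have [h1 h2] := hY s.1.1 s.1.2 t; rewrite /y /dy; case: s.2.
have bnd s (t : R) : 0 <= t <= b -> `|dy s t| <= K * (\sum_j `|y j t|) + d.
  move=> tb; apply: (@le_trans _ _ (nm (dY t s.1.1 s.1.2))).
    by rewrite /dy; case: s.2; [exact: Re_le_nm|exact: Im_le_nm].
  have -> : dY t s.1.1 s.1.2 = (A t *m Y t) s.1.1 s.1.2 + (dY t - A t *m Y t) s.1.1 s.1.2.
    have E : dY t = A t *m Y t + (dY t - A t *m Y t) by rewrite addrC subrK.
    by rewrite {1}E [in LHS]mxE.
  apply: le_trans (le_normcD _ _) _; apply: lerD; last exact: hd.
  rewrite mxE mulr_sumr.
  have sumle (J : finType) (F : J -> C) : nm (\sum_k F k) <= \sum_k nm (F k).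
    elim/big_ind2 : _ => [|? ? ? ? h1 h2|//]; first by rewrite Normc.normc0.
    by apply: le_trans (le_normcD _ _) _; exact: lerD.
  apply: le_trans (sumle _ _) _.
  apply: (@le_trans _ _ (\sum_k K * (`|Re (Y t k s.1.2)| + `|Im (Y t k s.1.2)|))).
    apply: ler_sum => k _; rewrite Normc.normcM.
    by apply: ler_pM; rewrite ?nm_ge0 // ?nm_le // hA.
  have -> : \sum_i K * `|y i t| =
      \sum_k \sum_l K * (`|Re (Y t k l)| + `|Im (Y t k l)|).
    rewrite pair_big /=; rewrite -(pair_big xpredT xpredT
      (fun (p : 'I_m * 'I_n) (e : bool) => K * `|y (p, e) t|)) /=.
    by apply: eq_bigr => p _; rewrite big_bool /y /= mulrDr.
  apply: ler_sum => k _; rewrite (bigD1 s.1.2) //= lerDl.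
  by apply: sumr_ge0 => l _; rewrite mulr_ge0 // addr_ge0.
have y00 s : y s 0 = 0 by rewrite /y Y0 !mxE; case: s.2.
have := gronwall K0 d0 b0 hy bnd y00.
have -> : #|I|%:R * d ^+ 2 * b * expR ((2 * K * #|I|%:R + 1) * b) =
  N * b * expR ((2 * K * N + 1) * b) * d ^+ 2 by rewrite -/N; ring.
by move=> H; split; [exact: (H ((i, j), true) x xb)|exact: (H ((i, j), false) x xb)].
Qed.

Lemma lin_unique m n (K b : R) (Y dY Z dZ : R -> 'M[C]_(m, n)) (A : R -> 'M[C]_m) :
  0 <= K -> 0 <= b -> mdiff Y dY -> mdiff Z dZ ->
  (forall x, 0 <= x <= b -> dY x = A x *m Y x) ->
  (forall x, 0 <= x <= b -> dZ x = A x *m Z x) ->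
  (forall x i j, 0 <= x <= b -> nm (A x i j) <= K) ->
  Y 0 = Z 0 -> forall x, 0 <= x <= b -> Y x = Z x.
Proof.
move=> K0 b0 hY hZ eY eZ hA YZ0 x xb; have [G G0 hG] := @lin_bound m n K b K0 b0.
pose D t := Y t + (-1) *: Z t.
have hD := mdiffD hY (mdiffZ (-1) hZ).
have D0 : D 0 = 0 by rewrite /D YZ0 scaleN1r subrr.
have hd t i j : 0 <= t <= b ->
    nm ((dY t + (-1) *: dZ t - A t *m D t) i j) <= 0.
  move=> tb; rewrite eY // eZ // /D mulmxDr scalemxAr subrr mxE Normc.normc0.
  exact: lexx.
apply/matrixP => i j; have [] := hG D _ A 0 (lexx 0) hD hd hA D0 x i j xb.
rewrite expr0n /= mulr0 => h1 h2.
have z (r : R) : r ^+ 2 <= 0 -> r = 0.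
  by move=> h; apply/eqP; rewrite -sqrf_eq0; apply/eqP/le_anti; rewrite h sqr_ge0.
have : D x i j = 0 by apply: complex_ext; exact: z.
by rewrite /D !mxE mulN1r => /eqP; rewrite subr_eq0 => /eqP.
Qed.

Definition rdiff m n (Y dY : R -> 'M[R]_(m, n)) := forall x i j,
  is_derive x 1 (fun y : R => Y y i j) (dY x i j).

Lemma rdiff_cst m n (A : 'M[R]_(m, n)) : rdiff (fun=> A) (fun=> 0).
Proof. by move=> x i j; rewrite mxE; exact: is_derive_const. Qed.

Lemma rdiffM m n p (Y dY : R -> 'M[R]_(m, n)) (Z dZ : R -> 'M[R]_(n, p)) :
  rdiff Y dY -> rdiff Z dZ ->
  rdiff (fun x => Y x *m Z x) (fun x => dY x *m Z x + Y x *m dZ x).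
Proof.
move=> hY hZ x i j; under eq_fun do rewrite mxE; rewrite !mxE -big_split /=.
by apply: (@is_derive_bigsum R _ (fun k x => Y x i k * Z x k j)
  (fun k x => dY x i k * Z x k j + Y x i k * dZ x k j)) => k; exact: is_derive_mul.
Qed.

Lemma rdiff_mdiff m n (Y dY : R -> 'M[R]_(m, n)) : rdiff Y dY ->
  mdiff (fun x => map_mx (real_complex R) (Y x)) (fun x => map_mx (real_complex R) (dY x)).
Proof.
move=> h i j; under eq_fun do rewrite mxE.
apply: (@cdiff_ext _ (fun x => (dY x i j)%:C)); last by move=> x; rewrite mxE.
by apply: cdiff_real => x; exact: h.
Qed.

Lemma bounded_on (g : R -> R) (b : R) : continuous g -> 0 <= b ->
  exists2 K, 0 <= K & forall x, 0 <= x <= b -> `|g x| <= K.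
Proof.
move=> cg b0; have cn : {within `[0, b], continuous (fun x => `|g x|)}.
  apply: continuous_subspaceT => x.
  by apply: continuous_comp; [exact: cg|exact: norm_continuous].
have [c _ hc] := EVT_max b0 cn.
exists `|g c|; first exact: normr_ge0.
by move=> x xb; apply: hc; rewrite in_itv.
Qed.

Lemma fin_bounded_on (I : finType) (g : I -> R -> R) (b : R) :
  (forall i, continuous (g i)) -> 0 <= b ->
  exists2 K, 0 <= K & forall i x, 0 <= x <= b -> `|g i x| <= K.
Proof.
move=> cg b0; have cn : continuous (fun x => \sum_i `|g i x|).
  move=> x; have -> : (fun x => \sum_i `|g i x|) = \sum_i (fun x => `|g i x|).
    by apply/funext => y; rewrite fct_sumE.
  elim/big_ind : _ => [|f1 f2 h1 h2|i _]; first exact: cst_continuous.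
    exact: continuousD.
  by apply: continuous_comp; [exact: cg|exact: norm_continuous].
have [K K0 hK] := bounded_on cn b0; exists K => // i x xb.
apply: le_trans (hK x xb); apply: le_trans (ler_norm _).
by rewrite (bigD1 i) //= lerDl sumr_ge0.
Qed.

End ComplexODE.

(** * The third order system and its monodromy *)

Local Notation i0 := (@Ordinal 3 0 isT).
Local Notation i1 := (@Ordinal 3 1 isT).
Local Notation i2 := (@Ordinal 3 2 isT).

Lemma ord3P (P : 'I_3 -> Prop) : P i0 -> P i1 -> P i2 -> forall i, P i.
Proof.
move=> h0 h1 h2 [[|[|[|//]]] hi]; [move: h0|move: h1|move: h2]; congr P; exact: val_inj.
Qed.

Lemma sum3 (V : nmodType) (F : 'I_3 -> V) : \sum_i F i = F i0 + F i1 + F i2.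
Proof.
rewrite !big_ord_recl big_ord0 addr0 addrA.
by congr (F _ + F _ + F _); exact: val_inj.
Qed.

(** * Determinants of 3 by 3 matrices *)

Section Det3.
Variable K : comNzRingType.
Implicit Types A N : 'M[K]_3.

Lemma det2 (A : 'M[K]_2) : \det A =
  A ord0 ord0 * A ord_max ord_max - A ord0 ord_max * A ord_max ord0.
Proof.
rewrite (expand_det_row _ ord0) !big_ord_recl big_ord0 addr0 /cofactor !det_mx11 !mxE /=.
have -> : lift ord0 (ord0 : 'I_1) = ord_max :> 'I_2 by exact: val_inj.
have -> : lift ord_max (ord0 : 'I_1) = ord0 :> 'I_2 by exact: val_inj.
by rewrite expr0 expr1; ring.
Qed.

Lemma lift3 : (lift i0 (ord0 : 'I_2) = i1) * (lift i0 (ord_max : 'I_2) = i2) *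
  (lift i1 (ord0 : 'I_2) = i0) * (lift i1 (ord_max : 'I_2) = i2) *
  (lift i2 (ord0 : 'I_2) = i0) * (lift i2 (ord_max : 'I_2) = i1).
Proof. by do !split; apply: val_inj. Qed.

Lemma det3 A : \det A =
  A i0 i0 * (A i1 i1 * A i2 i2 - A i1 i2 * A i2 i1)
  - A i0 i1 * (A i1 i0 * A i2 i2 - A i1 i2 * A i2 i0)
  + A i0 i2 * (A i1 i0 * A i2 i1 - A i1 i1 * A i2 i0).
Proof.
rewrite (expand_det_row _ i0) sum3 /cofactor !det2 !mxE !lift3 /=.
by rewrite -[(-1) ^+ (0 + 1)]/(-1) -[(-1) ^+ (0 + 2)]/(-1 * -1); ring.
Qed.

Lemma adj3_diag A : [/\ \adj A i0 i0 = A i1 i1 * A i2 i2 - A i1 i2 * A i2 i1,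
  \adj A i1 i1 = A i0 i0 * A i2 i2 - A i0 i2 * A i2 i0 &
  \adj A i2 i2 = A i0 i0 * A i1 i1 - A i0 i1 * A i1 i0].
Proof.
have s2 : (-1) ^+ (1 + 1) = 1 :> K by rewrite sqrrN expr1n.
have s4 : (-1) ^+ (2 + 2) = 1 :> K by rewrite -signr_odd.
by split; rewrite mxE /cofactor det2 !mxE !lift3 /= ?s2 ?s4 mul1r.
Qed.

(** The characteristic polynomial at 1 gives det (A - 1) = det A - tr (adj A) + tr A - 1, and the
    adjugate is the inverse when det A = 1. *)
Lemma det_sub1_unimodular A N : \det A = 1 -> A *m N = 1%:M ->
  \det (A - 1%:M) = \tr A - \tr N.
Proof.
move=> dA AN; have -> : N = \adj A.
  by rewrite -[LHS]mul1mx -dA -mul_adj_mx -mulmxA AN mulmx1.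
have [e0 e1 e2] := adj3_diag A.
rewrite /mxtrace !sum3 e0 e1 e2; move: dA; rewrite !det3 !mxE /= => dA.
apply/eqP; rewrite -subr_eq0; apply/eqP.
by rewrite -[RHS](subrr (1 : K)) -[X in _ = X - _]dA; ring.
Qed.

End Det3.

Section Limits.
Context {R : realType} {T : Type} {F : set_system T} {FF : Filter F}.

Lemma cvg_bigsum (I : Type) (r : seq I) (f : I -> T -> R) (l : I -> R) :
  (forall i, f i x @[x --> F] --> l i) ->
  (fun x => \sum_(i <- r) f i x) x @[x --> F] --> \sum_(i <- r) l i.
Proof.
move=> h; elim: r => [|i r IH].
  by rewrite big_nil; under eq_fun do rewrite big_nil; exact: cvg_cst.
rewrite big_cons; under eq_fun do rewrite big_cons.
exact: cvgD (h i) IH.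
Qed.

Lemma cvg_bigprod (I : Type) (r : seq I) (f : I -> T -> R) (l : I -> R) :
  (forall i, f i x @[x --> F] --> l i) ->
  (fun x => \prod_(i <- r) f i x) x @[x --> F] --> \prod_(i <- r) l i.
Proof.
move=> h; elim: r => [|i r IH].
  by rewrite big_nil; under eq_fun do rewrite big_nil; exact: cvg_cst.
rewrite big_cons; under eq_fun do rewrite big_cons.
exact: cvgM (h i) IH.
Qed.

Lemma cvg_mulmx m n p (A : T -> 'M[R]_(m, n)) (B : T -> 'M[R]_(n, p))
    (lA : 'M[R]_(m, n)) (lB : 'M[R]_(n, p)) :
  (forall i j, (fun x => A x i j) x @[x --> F] --> lA i j) ->
  (forall i j, (fun x => B x i j) x @[x --> F] --> lB i j) ->
  forall i j, (fun x => (A x *m B x) i j) x @[x --> F] --> (lA *m lB) i j.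
Proof.
move=> hA hB i j; rewrite mxE; under eq_fun do rewrite mxE.
by apply: cvg_bigsum => k; exact: cvgM.
Qed.

Lemma cvg_det n (A : T -> 'M[R]_n) (lA : 'M[R]_n) :
  (forall i j, (fun x => A x i j) x @[x --> F] --> lA i j) ->
  (fun x => \det (A x)) x @[x --> F] --> \det lA.
Proof.
move=> hA; apply: cvg_bigsum => s; apply: cvgMl_tmp.
by apply: cvg_bigprod => i; exact: hA.
Qed.

Lemma cvg_adj n (A : T -> 'M[R]_n) (lA : 'M[R]_n) :
  (forall i j, (fun x => A x i j) x @[x --> F] --> lA i j) ->
  forall i j, (fun x => (\adj (A x)) i j) x @[x --> F] --> (\adj lA) i j.
Proof.
move=> hA i j; rewrite mxE; under eq_fun do rewrite mxE.
apply: cvgMl_tmp; apply: cvg_det => k l; rewrite !mxE.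
by under eq_fun do rewrite !mxE; exact: hA.
Qed.

End Limits.

Section ThirdOrder.
Context {R : realType}.
Local Notation C := R[i].
Local Notation nm := (@Normc.normc R).
Local Notation toC := (real_complex R).
Local Notation Re := complex.Re.
Local Notation Im := complex.Im.
Variables (g h : R -> R).

(** Companion matrix of v''' = a v + b v', over any ring because it occurs with real and with
    complex entries. In the application [g] is u_x f''(u) and [h] is c - f'(u). *)
Definition sysmx (K : nzRingType) (a b : K) : 'M[K]_3 :=
  \matrix_(i < 3, j < 3) nth 0 (nth [::]
    [:: [:: 0; 1; 0]; [:: 0; 0; 1]; [:: a; b; 0]] i) j.

Definition Hm (x : R) (mu : C) : 'M[C]_3 := sysmx (- mu - (g x)%:C) (h x)%:C.
Definition Hr (x mu : R) : 'M[R]_3 := sysmx (- mu - g x) (h x).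

Lemma sysmx_mul (K : nzRingType) (a b : K) n (Y : 'M[K]_(3, n)) j :
  [/\ (sysmx a b *m Y) i0 j = Y i1 j, (sysmx a b *m Y) i1 j = Y i2 j &
      (sysmx a b *m Y) i2 j = a * Y i0 j + b * Y i1 j].
Proof. by split; rewrite mxE sum3 !mxE /= ?mul0r ?mul1r ?add0r ?addr0. Qed.

Lemma Hm_real x mu : Hm x mu%:C = map_mx toC (Hr x mu).
Proof.
apply/matrixP; apply: ord3P; apply: ord3P; rewrite !mxE //=.
by rewrite rmorphB rmorphN.
Qed.

(** The matrix of the system has trace zero: the derivative of the expanded determinant cancels
    identically. *)
Lemma liouville (a b : R -> C) (Y : R -> 'M[C]_3) :
  mdiff Y (fun x => sysmx (a x) (b x) *m Y x) -> forall x, \det (Y x) = \det (Y 0).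
Proof.
move=> hY; apply: (@cdiff_eq_cst _ (fun x => \det (Y x))).
under eq_fun do rewrite det3.
have mm (p q r s : 'I_3) (j k l m : 'I_3) :=
  cdiffD (cdiffM (hY p j) (hY q k)) (cdiffN (cdiffM (hY r l) (hY s m))).
have := cdiffD (cdiffD (cdiffM (hY i0 i0) (mm i1 i2 i1 i2 i1 i2 i2 i1))
  (cdiffN (cdiffM (hY i0 i1) (mm i1 i2 i1 i2 i0 i2 i2 i0))))
  (cdiffM (hY i0 i2) (mm i1 i2 i1 i2 i0 i1 i1 i0)).
move=> H; apply: cdiff_ext H _ => x /=.
have E j := sysmx_mul (a x) (b x) (Y x) j.
have [e00 e10 e20] := E i0; have [e01 e11 e21] := E i1; have [e02 e12 e22] := E i2.
rewrite e00 e10 e20 e01 e11 e21 e02 e12 e22; ring.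
Qed.

Hypotheses (cg : continuous g) (ch : continuous h).

Lemma Hm_bounded (b : R) : 0 <= b -> exists2 K, 0 <= K &
  forall mu x i j, 0 <= x <= b -> nm (Hm x mu i j) <= K + nm mu.
Proof.
move=> b0; have [G G0 hG] := bounded_on cg b0; have [L L0 hL] := bounded_on ch b0.
exists (1 + G + L) => [|mu x]; first by rewrite !addr_ge0.
have m0 := nm_ge0 mu.
apply: ord3P; apply: ord3P => xb; rewrite mxE /= ?expr0n ?expr1n /= ?addr0
  ?sqrtr0 ?sqrtr1 ?sqrtr_sqr; try lra.
  apply: le_trans (le_normcD _ _) _; rewrite !normcN nm_real.
  by have := hG x xb; lra.
by have := hL x xb; lra.
Qed.

Variable T : R.
Hypothesis T0 : 0 <= T.

(** * Reflection symmetry of the monodromy *)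

Section Reflection.
Hypotheses (sg : forall x, 0 <= x <= T -> g (T - x) = - g x)
  (sh : forall x, 0 <= x <= T -> h (T - x) = h x).
Variable Phi : R -> C -> 'M[C]_3.
Hypotheses (hPhi : forall mu, mdiff (Phi^~ mu) (fun x => Hm x mu *m Phi x mu))
  (Phi0 : forall mu, Phi 0 mu = 1%:M).

(** diag(1, -1, 1), the action of the reflection x -> T - x on (v, v', v''). *)
Definition Jmx : 'M[C]_3 := \matrix_(i, j) (((-1) ^+ i) *+ (i == j)).

Lemma Jmx_conj (A : 'M[C]_3) i j :
  (Jmx *m A *m Jmx) i j = (-1) ^+ i * A i j * (-1) ^+ j.
Proof.
rewrite mxE (bigD1 j) //= [X in _ + X]big1 => [|k kj]; last first.
  by rewrite [Jmx k j]mxE (negPf kj) mulr0.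
rewrite addr0 mxE (bigD1 i) //= big1 => [|k ki]; last first.
  by rewrite [Jmx i k]mxE eq_sym (negPf ki) mul0r.
by rewrite addr0 ![Jmx _ _]mxE !eqxx.
Qed.

Lemma JmxK : Jmx *m Jmx = 1%:M.
Proof.
have := Jmx_conj 1%:M; rewrite mulmx1 => E; apply/matrixP => i j; rewrite E mxE.
have [->|ij] := eqVneq i j; last by rewrite mulr0 mul0r.
by rewrite mulr1 -expr2 sqrr_sign.
Qed.

(* If v(x) solves the equation at -mu then v(T - x) solves it at mu. *)
Lemma monodromy_reflection mu : Phi T mu *m (Jmx *m Phi T (- mu) *m Jmx) = 1%:M.
Proof.
have [K K0 hK] := Hm_bounded T0.
pose Psi x := Jmx *m Phi (T - x) (- mu) *m Jmx.
pose A x := (-1) *: (Jmx *m Hm (T - x) (- mu) *m Jmx).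
have hPsi : mdiff Psi (fun x => A x *m Psi x).
  have h1 : mdiff (fun x => Phi (-1 * x + T) (- mu))
      (fun x => (-1)%:C *: (Hm (-1 * x + T) (- mu) *m Phi (-1 * x + T) (- mu))).
    move=> i j; have := cdiff_affine (-1) T (hPhi (- mu) i j).
    by move=> H; apply: cdiff_ext H _ => x; rewrite [RHS]mxE.
  have h2 := mdiff_mulr Jmx (mdiff_mull Jmx h1).
  apply: mdiff_ext h2 _ _ => x; rewrite ?mulN1r addrC // /A /Psi.
  rewrite rmorphN1 -!scalemxAr -!scalemxAl; congr (_ *: _).
  by rewrite !mulmxA -[_ *m Jmx *m Jmx]mulmxA JmxK mulmx1.
have AE x : 0 <= x <= T -> A x = Hm x mu.
  move=> xT; apply/matrixP => i j; rewrite mxE Jmx_conj.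
  move: i j; apply: ord3P; apply: ord3P;
    rewrite !mxE /= ?sg ?sh // ?(rmorphN toC) ?(expr0, expr1, sqrrN, expr1n); ring.
have Psi0 : Psi 0 = Jmx *m Phi T (- mu) *m Jmx by rewrite /Psi subr0.
(* [Psi] and [Phi x mu *m Psi 0] solve the same system with the same value at 0. Their equality is
   read off at [T], where [Psi] is the identity. *)
rewrite -Psi0 -[LHS]/((fun x => Phi x mu *m Psi 0) T).
have -> : 1%:M = Psi T by rewrite /Psi subrr Phi0 mulmx1 JmxK.
apply/esym; apply: (@lin_unique R 3 3 (K + nm mu) T Psi _ (fun x => Phi x mu *m Psi 0) _
  (fun x => Hm x mu) _ T0 hPsi (mdiff_mulr _ (hPhi mu))).
- by rewrite addr_ge0 // nm_ge0.
- by move=> x xT; rewrite AE.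
- by move=> x _; rewrite mulmxA.
- by move=> x i j; exact: hK.
- by rewrite Phi0 mul1mx.
- by rewrite T0 lexx.
Qed.

Lemma det_monodromy mu : \det (Phi T mu - 1%:M) = \tr (Phi T mu) - \tr (Phi T (- mu)).
Proof.
rewrite (det_sub1_unimodular _ (monodromy_reflection mu)).
  congr (_ - _); rewrite /mxtrace; apply: eq_bigr => i _.
  by rewrite Jmx_conj mulrAC -expr2 sqrr_sign mul1r.
by rewrite (liouville (hPhi mu)) Phi0 det1.
Qed.

End Reflection.

(** * Real spectral parameter and the sign for large mu *)

Section RealParameter.
Variables (Phi : R -> C -> 'M[C]_3) (mu : R).
Hypotheses (hPhi : mdiff (Phi^~ mu%:C) (fun x => Hm x mu%:C *m Phi x mu%:C))
  (Phi0 : Phi 0 mu%:C = 1%:M).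

Definition rePhi x : 'M[R]_3 := map_mx (@complex.Re R) (Phi x mu%:C).

Lemma rePhi_diff : rdiff rePhi (fun x => Hr x mu *m rePhi x).
Proof.
move=> x i j; have [H _] := hPhi i j x.
under eq_fun do rewrite mxE.
suff -> : (Hr x mu *m rePhi x) i j = Re ((Hm x mu%:C *m Phi x mu%:C) i j) by [].
rewrite Hm_real; have [e0 e1 e2] := sysmx_mul (- mu - g x) (h x) (rePhi x) j.
have E : map_mx toC (Hr x mu) = sysmx (- mu%:C - (g x)%:C) (h x)%:C by rewrite -Hm_real.
have [c0 c1 c2] := sysmx_mul (- mu%:C - (g x)%:C) (h x)%:C (Phi x mu%:C) j.
move: i {H}; apply: ord3P; rewrite E.
- by rewrite e0 c0 mxE.
- by rewrite e1 c1 mxE.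
rewrite e2 c2 !mxE ReD !ReM ReD !ReN ImD !ImN /=; ring.
Qed.

Lemma rePhi0 : rePhi 0 = 1%:M.
Proof.
apply/matrixP => i j; rewrite mxE Phi0 !mxE.
by case: eqP.
Qed.

(** For real mu the system is real, so the real part of [Phi] solves it with the same initial value;
    uniqueness makes the imaginary part vanish. *)
Lemma Phi_real x : 0 <= x <= T -> Phi x mu%:C = map_mx toC (rePhi x).
Proof.
move=> xT; have [K K0 hK] := Hm_bounded T0.
apply: (@lin_unique R 3 3 (K + nm mu%:C) T _ _ _ _ (fun x => Hm x mu%:C) _ T0 hPhi
  (rdiff_mdiff rePhi_diff)) => //.
- by rewrite addr_ge0 // nm_ge0.
- by move=> y _; rewrite map_mxM Hm_real.
- by move=> y i j; exact: hK.
- by rewrite Phi0 rePhi0 map_mx1.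
Qed.

Lemma det_rePhi x : 0 <= x <= T -> \det (rePhi x) = 1.
Proof.
move=> xT; apply: (@complexI R); rewrite -det_map_mx -Phi_real //.
by rewrite (liouville hPhi) Phi0 det1.
Qed.

(* In the rescaled variables b = (v, v'/k, v''/k^2) the constant coefficient part of
   the equation reads b0' = k b1, b1' = k b2, b2' = - k b0, and the quadratic form
   Q = |b|^2/2 + b0 b1 + b1 b2 - b0 b2 has derivative k |b|^2 along it. *)
Lemma det_sub1_neq0 (B k : R) : 0 <= B -> 3 * B + 1 <= k -> k ^+ 3 = mu ->
  (forall x, 0 <= x <= T -> `|g x| <= B) -> (forall x, 0 <= x <= T -> `|h x| <= B) ->
  forall x, 0 < x <= T -> \det (rePhi x - 1%:M) != 0.
Proof.
move=> B0 kB kmu hg hh x /andP[x0 xT]; apply/eqP => dx.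
have [w w0 hw] : exists2 w : 'rV_3, w != 0 & w *m (rePhi x - 1%:M)^T = 0.
  by apply/det0P; rewrite det_tr dx.
pose v := w^T.
have Pv : rePhi x *m v = v.
  apply/eqP; rewrite -subr_eq0 -[X in _ - X]mul1mx -mulmxBl.
  by rewrite -[rePhi x - _]trmxK -trmx_mul hw trmx0.
have hy : rdiff (fun t => rePhi t *m v) (fun t => Hr t mu *m (rePhi t *m v)).
  move=> t i j.
  by have := rdiffM rePhi_diff (rdiff_cst v) t i j; rewrite mulmx0 addr0 mulmxA.
pose z : 'I_1 := ord0.
pose y i t := (rePhi t *m v) i z.
have k1 : 1 <= k by lra.
have kn0 : k != 0 by rewrite gt_eqF //; lra.
pose b0 t := y i0 t; pose b1 t := k^-1 * y i1 t; pose b2 t := k^-1 ^+ 2 * y i2 t.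
pose p t := k^-1 ^+ 2 * g t; pose q t := k^-1 * h t.
have d0 (t : R) : is_derive t 1 b0 (k * b1 t).
  have [e _ _] := sysmx_mul (- mu - g t) (h t) (rePhi t *m v) z.
  have -> : k * b1 t = (Hr t mu *m (rePhi t *m v)) i0 z by rewrite e /b1 /y mulVKf.
  exact: hy.
have d1 (t : R) : is_derive t 1 b1 (k * b2 t).
  have [_ e _] := sysmx_mul (- mu - g t) (h t) (rePhi t *m v) z.
  have -> : k * b2 t = k^-1 * (Hr t mu *m (rePhi t *m v)) i1 z.
    by rewrite e /b2 /y; field.
  by apply: is_derive_scale; exact: hy.
have d2 (t : R) : is_derive t 1 b2 (- k * b0 t - p t * b0 t + q t * b1 t).
  have [_ _ e] := sysmx_mul (- mu - g t) (h t) (rePhi t *m v) z.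
  have -> : - k * b0 t - p t * b0 t + q t * b1 t =
      k^-1 ^+ 2 * (Hr t mu *m (rePhi t *m v)) i2 z.
    by rewrite e /b0 /b1 /p /q /y -kmu; field.
  by apply: is_derive_scale; exact: hy.
pose Q t := 2^-1 * (b0 t * b0 t + (b1 t * b1 t + b2 t * b2 t)) +
  (b0 t * b1 t + (b1 t * b2 t + - (b0 t * b2 t))).
pose N t := b0 t ^+ 2 + b1 t ^+ 2 + b2 t ^+ 2.
pose dQ t := k * N t + (b2 t + b1 t - b0 t) * (q t * b1 t - p t * b0 t).
have hQ (t : R) : is_derive t 1 Q (dQ t).
  have := is_derive_add (is_derive_scale 2^-1 (is_derive_add (is_derive_mul (d0 t) (d0 t))
    (is_derive_add (is_derive_mul (d1 t) (d1 t)) (is_derive_mul (d2 t) (d2 t)))))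
    (is_derive_add (is_derive_mul (d0 t) (d1 t)) (is_derive_add (is_derive_mul (d1 t) (d2 t))
    (is_derive_opp (is_derive_mul (d0 t) (d2 t))))).
  by move=> H; apply: (is_derive_eq H); rewrite /dQ /N; field.
(* The fixed vector brings [Q] back to its initial value, so [dQ] vanishes at some intermediate [t].
   This will force the solution to vanish at [t], against the invertibility of [rePhi t]. *)
have QE : Q x = Q 0.
  have e i : y i x = y i 0 by rewrite /y Pv rePhi0 mul1mx.
  by rewrite /Q /b0 /b1 /b2 !e.
have [t /andP[t0 tx]] := mvt_oo x0 hQ.
rewrite QE subrr subr0 => /esym/eqP; rewrite mulf_eq0 [x == 0]gt_eqF // orbF => /eqP dQ0.
have tT : 0 <= t <= T by rewrite ltW // (le_trans (ltW tx)).
have ki : 0 <= k^-1 <= 1 by rewrite invr_ge0 invf_le1; lra.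
move/andP: ki => [ki0 ki1].
have hp : `|p t| <= B.
  rewrite /p normrM ger0_norm ?exprn_ge0 //; apply: le_trans (hg t tT).
  by apply: ler_piMl => //; exact: exprn_ile1.
have hq : `|q t| <= B.
  rewrite /q normrM ger0_norm //; apply: le_trans (hh t tT).
  exact: ler_piMl.
pose S := `|b0 t| + `|b1 t| + `|b2 t|.
have S2 : S ^+ 2 <= 3 * N t.
  rewrite /N -[b0 t ^+ 2]real_normK ?num_real // -[b1 t ^+ 2]real_normK ?num_real //.
  rewrite -[b2 t ^+ 2]real_normK ?num_real // /S.
  have := sqr_ge0 (`|b0 t| - `|b1 t|); have := sqr_ge0 (`|b0 t| - `|b2 t|).
  have := sqr_ge0 (`|b1 t| - `|b2 t|); nra.
(* The variable coefficients contribute at most B S^2 <= 3 B N to [dQ]; since k >= 3 B + 1, the term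
   k N exceeds this by at least N. *)
have bd : `|(b2 t + b1 t - b0 t) * (q t * b1 t - p t * b0 t)| <= B * (3 * N t).
  apply: (@le_trans _ _ (S * (B * S))); last first.
    by rewrite mulrCA -expr2; apply: ler_wpM2l.
  rewrite normrM; apply: ler_pM => //.
    apply: le_trans (ler_normB _ _) _; rewrite /S.
    by have := ler_normD (b2 t) (b1 t); lra.
  apply: le_trans (ler_normB _ _) _; rewrite [`|q t * _|]normrM [`|p t * _|]normrM.
  apply: (@le_trans _ _ (B * `|b1 t| + B * `|b0 t|)).
    by apply: lerD; apply: ler_wpM2r.
  by rewrite -mulrDr; apply: ler_wpM2l => //; rewrite /S; have := normr_ge0 (b2 t); lra.
have N0 : N t = 0.
  apply/le_anti; rewrite {2}/N !addr_ge0 ?sqr_ge0 // andbT.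
  have Ng : 0 <= N t by rewrite /N !addr_ge0 ?sqr_ge0.
  move: bd; rewrite ler_norml => /andP[bd _]; move: dQ0; rewrite /dQ => dQ0.
  have : (3 * B + 1) * N t <= k * N t by apply: ler_wpM2r.
  lra.
have [z0 z1 z2] : [/\ b0 t = 0, b1 t = 0 & b2 t = 0].
  have s0 := sqr_ge0 (b0 t); have s1 := sqr_ge0 (b1 t); have s2 := sqr_ge0 (b2 t).
  by split; apply/eqP; rewrite -sqrf_eq0; apply/eqP; move: N0; rewrite /N; lra.
have Pv0 : rePhi t *m v = 0.
  apply/matrixP => i j; rewrite [RHS]mxE (ord1 j) -/z -/(y i t).
  move: i; apply: ord3P; first exact: z0.
    by move/eqP: z1; rewrite mulf_eq0 invr_eq0 (negPf kn0) => /eqP.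
  by move/eqP: z2; rewrite mulf_eq0 sqrf_eq0 invr_eq0 (negPf kn0) => /eqP.
have ut : rePhi t \in unitmx by rewrite unitmxE det_rePhi ?unitr1.
move: w0; rewrite -[w]trmxK -/v -[v](mulKmx ut) Pv0 mulmx0 trmx0 eqxx //.
Qed.

Lemma is_derive_cvg0 (f : R -> R) (df : R) : is_derive (0 : R) (1 : R) f df ->
  (fun t : R => t^-1 * (f t - f 0)) t @[t --> 0^'] --> df.
Proof.
move=> [dv <-].
have E : (fun t : R => t^-1 *: (f (t *: (1 : R) + 0) - f 0)) =
    (fun t : R => t^-1 * (f t - f 0)).
  by apply/funext => t; rewrite addr0 /GRing.scale /= mulr1.
by rewrite -E; exact: dv.
Qed.

(** (Phi(x) - 1) / x tends to the system matrix at 0, whose determinant is - (mu + g 0); scaling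
    back multiplies by x^3. *)
Lemma det_sub1_neg_near0 : 0 < T -> 0 < mu + g 0 ->
  exists2 x, 0 < x <= T & \det (rePhi x - 1%:M) < 0.
Proof.
move=> Tp mg.
have lim : (fun t : R => \det (t^-1 *: (rePhi t - 1%:M))) t @[t --> 0^'] --> \det (Hr 0 mu).
  apply: cvg_det => i j.
  have := is_derive_cvg0 (rePhi_diff 0 i j); rewrite rePhi0 mulmx1.
  have -> // : (fun t : R => t^-1 * (rePhi t i j - (1%:M : 'M[R]_3) i j)) =
    (fun t => (t^-1 *: (rePhi t - 1%:M)) i j).
  by apply/funext => t; rewrite [RHS]mxE [(rePhi t - _) i j]mxE [(- 1%:M : 'M[R]_3) i j]mxE.
have dH : \det (Hr 0 mu) = - (mu + g 0) by rewrite det3 !mxE /=; ring.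
rewrite dH in lim; have /cvgrPdist_lt/(_ _ mg)/nbhs_ballP[d /= d0 hd] := lim.
pose m := Num.min d T; have m0 : 0 < m by rewrite lt_min d0.
have [md mT] : m <= d /\ m <= T by rewrite /m !ge_min !lexx orbT.
have t0 : 0 < m / 2 by lra.
exists (m / 2); first by rewrite t0 /=; lra.
have := hd (m / 2); rewrite /ball /= sub0r normrN gtr0_norm // => H.
have {H} : `|- (mu + g 0) - \det ((m / 2)^-1 *: (rePhi (m / 2) - 1%:M))| < mu + g 0.
  by apply: H; [lra|rewrite gt_eqF].
rewrite detZ ltr_norml => /andP[h1 _].
have h2 : (m / 2)^-1 ^+ 3 * \det (rePhi (m / 2) - 1%:M) < 0 by lra.
by rewrite pmulr_rlt0 // exprn_gt0 // invr_gt0 in h2.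
Qed.

End RealParameter.

Lemma det_monodromy_neg (Phi : R -> C -> 'M[C]_3) :
  (forall mu, mdiff (Phi^~ mu) (fun x => Hm x mu *m Phi x mu)) ->
  (forall mu, Phi 0 mu = 1%:M) -> 0 < T ->
  exists K : R, forall mu : R, K <= mu -> Re (\det (Phi T mu%:C - 1%:M)) < 0.
Proof.
move=> hPhi Phi0 Tp.
have [G G0 hG] := bounded_on cg T0; have [L L0 hL] := bounded_on ch T0.
pose B := G + L; pose k0 := 3 * B + 1.
have B0 : 0 <= B by rewrite addr_ge0.
exists (k0 ^+ 3) => mu hmu.
have k00 : 1 <= k0 by rewrite /k0; lra.
have mu0 : 0 <= mu by apply: le_trans hmu; rewrite exprn_ge0 //; lra.
pose k := mu `^ 3^-1.
have k3 : k ^+ 3 = mu.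
  by rewrite -powR_mulrn ?powR_ge0 // -powRrM mulVf ?powRr1.
have kk : k0 <= k.
  rewrite leNgt; apply/negP => kl; move: hmu; rewrite -k3 leNgt => /negP; apply.
  by rewrite ltrXn2r ?nnegrE ?powR_ge0 //; lra.
have bg x : 0 <= x <= T -> `|g x| <= B by move=> /hG; rewrite /B; lra.
have bh x : 0 <= x <= T -> `|h x| <= B by move=> /hL; rewrite /B; lra.
pose P := rePhi Phi mu.
have nz := det_sub1_neq0 (hPhi mu%:C) (Phi0 mu%:C) B0 kk k3 bg bh.
have mg : 0 < mu + g 0.
  have := bg 0; rewrite lexx T0 => /(_ isT); rewrite ler_norml => /andP[h1 _].
  have : k0 <= k0 ^+ 3 by rewrite exprS ler_peMr ?exprn_ege1 //; lra.
  by rewrite /k0 in hmu *; lra.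
have [x /andP[x0 xT] dx] := det_sub1_neg_near0 (hPhi mu%:C) (Phi0 mu%:C) Tp mg.
have -> : Phi T mu%:C - 1%:M = map_mx toC (P T - 1%:M).
  by rewrite map_mxB map_mx1 -(Phi_real (hPhi mu%:C) (Phi0 mu%:C)) // T0 lexx.
rewrite det_map_mx /= ltNge; apply/negP => dT.
have cd : continuous (fun t => \det (P t - 1%:M)).
  move=> t; apply: cvg_det => i j; rewrite !mxE; under eq_fun do rewrite !mxE.
  apply: cvgB; last exact: cvg_cst.
  exact: (is_derive_continuous (hPhi mu%:C i j t).1).
have [||t] := @IVT R (fun t => \det (P t - 1%:M)) x T 0 xT.
- exact: continuous_subspaceT.
- by rewrite ge_min le_max (ltW dx) dT orbT.
rewrite in_itv /= => /andP[xt tT] /eqP; apply/negP; apply: nz.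
by rewrite tT (lt_le_trans x0).
Qed.

End ThirdOrder.

(** * Expansion of the monodromy in the spectral parameter *)

Section Picard.
Context {R : realType}.

Definition mcontinuous m n (Y : R -> 'M[R]_(m, n)) := forall i j, continuous (fun x => Y x i j).

Lemma rdiff_continuous m n (Y dY : R -> 'M[R]_(m, n)) : rdiff Y dY -> mcontinuous Y.
Proof. by move=> h i j x; exact: is_derive_continuous (h x i j). Qed.

Lemma mcontinuousM m n p (A : R -> 'M[R]_(m, n)) (B : R -> 'M[R]_(n, p)) :
  mcontinuous A -> mcontinuous B -> mcontinuous (fun x => A x *m B x).
Proof. by move=> hA hB i j x; apply: cvg_mulmx => k l; [exact: hA|exact: hB]. Qed.

Lemma antiderivative_mx m n (Y : R -> 'M[R]_(m, n)) : mcontinuous Y ->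
  exists Z, rdiff Z Y /\ Z 0 = 0.
Proof.
move=> hY; have /choice[G hG] (ij : 'I_m * 'I_n) : exists G : R -> R,
    G 0 = 0 /\ forall x : R, is_derive x 1 G (Y x ij.1 ij.2).
  exact: antiderivative (hY _ _).
exists (fun x => \matrix_(i, j) G (i, j) x); split => [x i j|].
  by under eq_fun do rewrite mxE; exact: (hG (i, j)).2.
by apply/matrixP => i j; rewrite !mxE; exact: (hG (i, j)).1.
Qed.

Lemma mcontinuous_bounded m n (Y : R -> 'M[R]_(m, n)) (b : R) : mcontinuous Y -> 0 <= b ->
  exists2 K, 0 <= K & forall x i j, 0 <= x <= b -> `|Y x i j| <= K.
Proof.
move=> hY b0.
have [K K0 hK] := @fin_bounded_on R ('I_m * 'I_n)%type (fun ij x => Y x ij.1 ij.2) b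
  (fun ij => hY ij.1 ij.2) b0.
by exists K => // x i j xb; exact: (hK (i, j) x xb).
Qed.

Variables (n : nat) (S : R -> 'M[R]_n).
Hypothesis cS : mcontinuous S.

(* The coefficients in mu of the solution of W' = mu S W with W(0) = 1. *)
Fixpoint picard k : R -> 'M[R]_n := if k is k'.+1 then
  xget (fun=> 0) [set Z | rdiff Z (fun x => S x *m picard k' x) /\ Z 0 = 0]
  else fun=> 1%:M.

Lemma picard_continuous k : mcontinuous (picard k) /\
  rdiff (picard k.+1) (fun x => S x *m picard k x) /\ picard k.+1 0 = 0.
Proof.
have step j : mcontinuous (picard j) ->
    rdiff (picard j.+1) (fun x => S x *m picard j x) /\ picard j.+1 0 = 0.
  move=> hj; have [Z hZ] := antiderivative_mx (mcontinuousM cS hj).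
  by rewrite /=; case: xgetP => [y -> //|/(_ Z)].
suff hk : mcontinuous (picard k) by split => //; exact: step.
elim: k => [|k IH]; last by have [H _] := step k IH; exact: rdiff_continuous H.
by move=> i j x; exact: cvg_cst.
Qed.

Lemma picard_bound (s b : R) : 0 <= s ->
  (forall x i j, 0 <= x <= b -> `|S x i j| <= s) ->
  forall k x i j, 0 <= x <= b ->
    `|picard k x i j| <= (n%:R * s) ^+ k * (x ^+ k / k`!%:R).
Proof.
move=> s0 hs; elim=> [|k IH] x i j xb.
  rewrite !expr0 fact0 divr1 mulr1 /= mxE.
  by case: eqP => _; rewrite ?normr1 ?normr0 ?lexx ?ler01.
have [_ [hd h0]] := picard_continuous k; move/andP: (xb) => [x0 xb1].
have := @norm_le_of_derive R (fun y => picard k.+1 y i j)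
  (fun y => (n%:R * s) ^+ k.+1 * ((y - 0) ^+ k.+1 / k.+1`!%:R))
  (fun y => (S y *m picard k y) i j)
  (fun y => (n%:R * s) ^+ k.+1 * ((y - 0) ^+ k / k`!%:R)) 0 x x0.
rewrite h0 mxE !subr0 expr0n /= mul0r mulr0 subr0; apply.
- by move=> y _; exact: hd.
- by move=> y _; apply: is_derive_scale; exact: is_derive_expn_fact.
move=> y /andP[y0 yx]; have yb : 0 <= y <= b by rewrite y0 (le_trans yx).
rewrite subr0 mxE; apply: le_trans (ler_norm_sum _ _ _) _.
apply: (@le_trans _ _ (\sum_(l < n) s * ((n%:R * s) ^+ k * (y ^+ k / k`!%:R)))).
  by apply: ler_sum => l _; rewrite normrM; apply: ler_pM => //; [exact: hs|exact: IH].
by rewrite sumr_const card_ord -[_ *+ n]mulr_natl exprS !mulrA.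
Qed.

End Picard.

Section Expansion.
Context {R : realType}.
Local Notation C := R[i].
Local Notation Re := complex.Re.
Local Notation Im := complex.Im.
Local Notation nm := (@Normc.normc R).
Local Notation toC := (real_complex R).
Variables (g h : R -> R) (cg : continuous g) (ch : continuous h) (T : R) (T0 : 0 <= T).
Variable Phi : R -> C -> 'M[C]_3.
Hypotheses (hPhi : forall mu, mdiff (Phi^~ mu) (fun x => Hm g h x mu *m Phi x mu))
  (Phi0 : forall mu, Phi 0 mu = 1%:M).

Definition E20 (K : nzRingType) : 'M[K]_3 := delta_mx i2 i0.

Lemma E20_mul (K : nzRingType) n (Y : 'M[K]_(3, n)) i j :
  (E20 K *m Y) i j = if i == i2 then Y i0 j else 0.
Proof.
by rewrite mxE sum3 !mxE /=; move: i; apply: ord3P; rewrite /= ?mul0r ?mul1r ?addr0.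
Qed.

Let P := rePhi Phi 0.
(** Variation of constants about mu = 0: Phi(x, mu) = P W with W' = mu S W, since the system matrix
    depends on mu through - mu [E20]. The adjugate stands for the inverse, as det P = 1 on [0, T],
    and its continuity is immediate from that of the entries. *)
Let S x := \adj (P x) *m (- E20 R) *m P x.
Let W := picard S.
Let V k x := P x *m W k x.
Let dV k x := (Hr g h x 0 *m P x) *m W k x +
  P x *m (if k is k'.+1 then S x *m W k' x else 0).

Let PP : rdiff P (fun x => Hr g h x 0 *m P x). Proof. exact: rePhi_diff. Qed.

Let cP : mcontinuous P. Proof. exact: rdiff_continuous PP. Qed.

Let cS : mcontinuous S.
Proof.
apply: mcontinuousM => //; apply: mcontinuousM => [i j x|i j x]; last exact: cvg_cst.
by apply: cvg_adj => k l; exact: cP.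
Qed.

Let VdV k : rdiff (V k) (dV k).
Proof.
apply: rdiffM => //; case: k => [|k]; last by have [_ []] := picard_continuous cS k.
exact: rdiff_cst.
Qed.

Let dVE k x : 0 <= x <= T ->
  dV k x = Hr g h x 0 *m V k x - (if k is k'.+1 then E20 R *m V k' x else 0).
Proof.
move=> xT; rewrite /dV /V mulmxA; congr (_ + _); case: k => [|k].
  by rewrite mulmx0 oppr0.
rewrite !mulmxA mul_mx_adj (det_rePhi cg ch T0 (hPhi _) (Phi0 _)) // mul1mx.
by rewrite !mulNmx.
Qed.

(** The constant [B] carries a factor [T]. That it vanishes with [T] later excludes [T = 0], where
    all coefficients beyond the first would be 0. *)
Let bndV : exists A B, [/\ 0 <= A, 0 <= B, (T = 0 -> B = 0) &
  forall k x i j, 0 <= x <= T -> `|V k x i j| <= A * B ^+ k / k`!%:R].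
Proof.
have [s s0 hs] := mcontinuous_bounded cS T0.
have [p p0 hp] := mcontinuous_bounded cP T0.
exists (3 * p), (3 * s * T); split => [|||k x i j xT]; rewrite ?mulr_ge0 //.
  by move=> ->; rewrite mulr0.
rewrite mxE; apply: le_trans (ler_norm_sum _ _ _) _.
apply: (@le_trans _ _ (\sum_(l < 3) p * ((3 * s) ^+ k * (T ^+ k / k`!%:R)))).
  apply: ler_sum => l _; rewrite normrM; apply: ler_pM => //; first exact: hp.
  apply: le_trans (picard_bound cS s0 hs _ _ _ xT) _.
  apply: ler_wpM2l; first by rewrite exprn_ge0 // mulr_ge0.
  apply: ler_wpM2r; first by rewrite invr_ge0 ler0n.
  by move/andP: xT => [x0 xT]; apply: lerXn2r; rewrite ?nnegrE.
by rewrite sumr_const card_ord -[_ *+ 3]mulr_natl !exprMn !mulrA.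
Qed.

Section Partial.
Variable mu : C.

Local Notation toCm := (map_mx toC).

Let Z := fix Z N (x : R) : 'M[C]_3 := if N is N'.+1 then
  Z N' x + mu ^+ N'.+1 *: toCm (V N'.+1 x) else toCm (V 0%N x).

Let dZ := fix dZ N (x : R) : 'M[C]_3 := if N is N'.+1 then
  dZ N' x + mu ^+ N'.+1 *: toCm (dV N'.+1 x) else toCm (dV 0%N x).

Let ZdZ N : mdiff (Z N) (dZ N).
Proof.
elim: N => [|N IH] /=; first exact: (rdiff_mdiff (VdV 0)).
by apply: mdiffD => //; apply: mdiffZ; exact: (rdiff_mdiff (VdV N.+1)).
Qed.

Let HmE x : Hm g h x mu = toCm (Hr g h x 0) - mu *: E20 C.
Proof.
apply/matrixP; apply: ord3P; apply: ord3P; rewrite !mxE /= ?mulr0 ?mulr1 ?subr0 //.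
by rewrite rmorphB rmorphN rmorph0 oppr0 sub0r addrC.
Qed.

Let linear_step (X E Y A B : 'M[C]_3) (z : C) :
  (X - mu *: E) *m Y + z *: (E *m A) + z *: (X *m B - E *m A) =
  (X - mu *: E) *m (Y + z *: B) + (z * mu) *: (E *m B).
Proof.
rewrite mulmxDr -!addrA; congr (_ + _).
rewrite -scalerDr [_ + (_ - _)]addrC subrK -scalemxAr mulmxBl -scalemxAl scalerBr scalerA.
by rewrite subrK.
Qed.

Let dVC k x : 0 <= x <= T -> toCm (dV k x) = toCm (Hr g h x 0) *m toCm (V k x) -
  (if k is k'.+1 then E20 C *m toCm (V k' x) else 0).
Proof.
move=> xT; rewrite dVE // map_mxB map_mxM; congr (_ - _).
case: k => [|k]; first exact: map_mx0.
by rewrite map_mxM map_delta_mx.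
Qed.

(** The equations of consecutive coefficients telescope: a partial sum solves the system up to the
    single term that the next coefficient would cancel. *)
Let dZE N x : 0 <= x <= T ->
  dZ N x = Hm g h x mu *m Z N x + mu ^+ N.+1 *: (E20 C *m toCm (V N x)).
Proof.
move=> xT; rewrite HmE; elim: N => [|N IH] /=.
  by rewrite dVC // subr0 mulmxBl -scalemxAl expr1 subrK.
have := linear_step (toCm (Hr g h x 0)) (E20 C) (Z N x) (toCm (V N x))
  (toCm (V N.+1 x)) (mu ^+ N.+1).
by rewrite -exprSr IH (dVC N.+1 xT).
Qed.

Let Z0 N : Z N 0 = 1%:M.
Proof.
have V0 k : V k 0 = if k is 0%N then 1%:M else 0.
  rewrite /V /P rePhi0 // mul1mx; case: k => // k.
  by have [_ [_]] := picard_continuous cS k.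
elim: N => [|N IH] /=; first by rewrite V0 map_mx1.
by rewrite IH V0 map_mx0 scaler0 addr0.
Qed.

(** [lin_bound] turns the defect d_N = |mu|^(N+1) A B^N / N! of the N-th partial sum into an error
    of at most sqrt(G) d_N, a multiple of an exponential series term. *)
Lemma partial_sums_cvg i j :
  sums_to (fun k => (V k T i j)%:C * mu ^+ k) (Phi T mu i j).
Proof.
have [K K0 hK] := Hm_bounded cg ch T0.
have [A [B [A0 B0 _ hV]]] := bndV.
have K1 : 0 <= K + nm mu by rewrite addr_ge0 // nm_ge0.
have [G G0 hG] := @lin_bound R 3 3 (K + nm mu) T K1 T0.
have TT : 0 <= T <= T by rewrite T0 lexx.
pose d N := nm mu ^+ N.+1 * (A * B ^+ N / N`!%:R).
have d0 N : 0 <= d N by rewrite !mulr_ge0 ?exprn_ge0 ?invr_ge0 ?ler0n // nm_ge0.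
have key N : Re (Z N T i j - Phi T mu i j) ^+ 2 <= G * d N ^+ 2 /\
    Im (Z N T i j - Phi T mu i j) ^+ 2 <= G * d N ^+ 2.
  have hY := mdiffD (ZdZ N) (mdiffZ (-1) (hPhi mu)).
  have := hG _ _ (fun x => Hm g h x mu) (d N) (d0 N) hY.
  have -> : Z N T i j - Phi T mu i j = (Z N T + (-1) *: Phi T mu) i j.
    by rewrite mxE [X in _ = _ + X]mxE mulN1r.
  apply => //.
  - move=> x k l xT; rewrite dZE // mulmxDr -[Hm g h x mu *m (_ *: _)]scalemxAr.
    have cancel (a b c : 'M[C]_3) : a + b + c - (a + c) = b.
      by rewrite [a + b]addrC -[b + a + c]addrA addrK.
    rewrite cancel mxE Normc.normcM nmX /d.
    apply: ler_wpM2l; first by rewrite exprn_ge0 // nm_ge0.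
    rewrite E20_mul; case: ifP => _; first by rewrite mxE nm_real; exact: hV.
    by rewrite Normc.normc0 !mulr_ge0 ?exprn_ge0 ?invr_ge0 ?ler0n.
  - by move=> x k l; exact: hK.
  - by rewrite Z0 Phi0 scaleN1r subrr.
have ZE N : Z N T i j = \sum_(0 <= k < N.+1) (V k T i j)%:C * mu ^+ k.
  elim: N => [|N IH]; first by rewrite big_nat1 expr0 mulr1 /= mxE.
  by rewrite big_nat_recr //= -IH mxE [X in _ + X]mxE [toCm _ _ _]mxE [mu ^+ _ * _]mulrC.
have cd : (fun N => Num.sqrt G * d N) @ \oo --> 0.
  have -> : (fun N => Num.sqrt G * d N) =
      (fun N => (Num.sqrt G * (nm mu * A)) * exp_coeff (nm mu * B) N).
    by apply/funext => N; rewrite /d /exp_coeff /= exprMn exprS; ring.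
  rewrite -[0](mulr0 (Num.sqrt G * (nm mu * A))); apply: cvgMl_tmp.
  by apply: cvg_series_cvg_0; exact: is_cvg_series_exp_coeff.
have sq (x y : R) N : (x - y) ^+ 2 <= G * d N ^+ 2 -> `|x - y| <= Num.sqrt G * d N.
  move=> H; rewrite -sqrtr_sqr -[d N]ger0_norm // -sqrtr_sqr -sqrtrM //.
  by rewrite ler_sqrt // mulr_ge0 // sqr_ge0.
have lim (u : nat -> R) (l : R) : (forall N, `|u N - l| <= Num.sqrt G * d N) ->
    u @ \oo --> l.
  move=> H; apply/cvgrPdist_le => e e0.
  have /cvgrPdist_le/(_ _ e0) := cd; apply: filterS => N; rewrite sub0r normrN => H1.
  by rewrite distrC; apply: le_trans (H N) _; apply: le_trans H1; exact: ler_norm.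
split; rewrite -cvg_shiftS /=; apply: lim => N; rewrite -ZE; apply: sq.
  by have [+ _] := key N; rewrite ReD ReN.
by have [_ +] := key N; rewrite ImD ImN.
Qed.

End Partial.

(** Besides the series, the first coefficient is provided as a function of x: [V1] is the derivative
    of [Phi] in mu at 0, and its inhomogeneous equation is what the first integral is tested on. *)
Lemma Phi_expansion : exists (w : 'I_3 -> 'I_3 -> nat -> R) (A B : R),
  [/\ forall i j, exp_type (w i j) A B,
      forall mu i j, Phi T mu i j = psum (w i j) mu,
      T = 0 -> B = 0 &
      exists V1 dV1 : R -> 'M[R]_3,
        [/\ rdiff V1 dV1,
          forall x, 0 <= x <= T ->
            dV1 x = Hr g h x 0 *m V1 x - E20 R *m rePhi Phi 0 x,
          V1 0 = 0 & forall i j, w i j 1%N = V1 T i j]].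
Proof.
have [A [B [A0 B0 BT hV]]] := bndV.
have TT : 0 <= T <= T by rewrite T0 lexx.
exists (fun i j k => V k T i j), A, B.
have ha i j : exp_type (fun k => V k T i j) A B by split => // k; exact: hV.
split => //.
  by move=> mu i j; apply: psum_unique (ha i j) _; exact: partial_sums_cvg.
exists (V 1%N), (dV 1%N); split => //.
- by move=> x xT; rewrite dVE // /V /W /= mulmx1.
- have [_ [_ W10]] := picard_continuous cS 0.
  by rewrite /V /W W10 mulmx0.
Qed.

End Expansion.

(** * Positive zeros of D(mu, 1) *)

Section Instability.
Context {R : realType}.
Local Notation C := R[i].
Local Notation Re := complex.Re.
Local Notation toC := (real_complex R).

Lemma psum_add (a b : nat -> R) A B A' B' A'' B'' (z : C) :
  exp_type a A B -> exp_type b A' B' -> exp_type (fun n => a n + b n) A'' B'' ->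
  psum (fun n => a n + b n) z = psum a z + psum b z.
Proof.
move=> ha hb hab; apply/esym; apply: psum_unique hab _.
have := sums_toD (psumP z ha).1 (psumP z hb).1.
by congr (sums_to _ _); apply/funext => n; rewrite rmorphD mulrDl.
Qed.

Lemma psum_odd_part (a : nat -> R) A B (z : C) : exp_type a A B ->
  exp_type (fun n => a n - (-1) ^+ n * a n) (2 * A) B /\
  psum (fun n => a n - (-1) ^+ n * a n) z = psum a z - psum a (- z).
Proof.
move=> ha; have [A0 B0 hb] := ha.
have hd : exp_type (fun n => a n - (-1) ^+ n * a n) (2 * A) B.
  split => // [|n]; first by rewrite mulr_ge0.
  apply: le_trans (ler_normB _ _) _; rewrite normrM normrX normrN1 expr1n mul1r.
  by have := hb n; lra.
split => //; apply/esym; apply: psum_unique hd _.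
have := sums_toD (psumP z ha).1 (sums_toM (-1) (psumP (- z) ha).1).
rewrite mulN1r; congr (sums_to _ _); apply/funext => n.
have -> : (a n - (-1) ^+ n * a n)%:C = (a n)%:C - (-1) ^+ n * (a n)%:C :> C.
  by rewrite (rmorphB toC) (rmorphM toC) (rmorphXn toC) (rmorphN1 toC).
rewrite [(- z) ^+ n]exprNn; ring.
Qed.

Variables (g h : R -> R) (cg : continuous g) (ch : continuous h) (T : R) (T0 : 0 <= T).
Hypotheses (dh : forall x : R, is_derive x 1 h (- g x))
  (sg : forall x, 0 <= x <= T -> g (T - x) = - g x)
  (sh : forall x, 0 <= x <= T -> h (T - x) = h x).
Variable Phi : R -> C -> 'M[C]_3.
Hypotheses (hPhi : forall mu, mdiff (Phi^~ mu) (fun x => Hm g h x mu *m Phi x mu))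
  (Phi0 : forall mu, Phi 0 mu = 1%:M).
Local Notation P := (rePhi Phi 0).
(** In the application [U] is the profile divided by u''(0), because the second column of [P] begins
    with u_x / u''(0). *)
Variable U : R -> R.
Hypotheses (dU : forall x : R, 0 <= x <= T -> is_derive x 1 U (P x i0 i1)) (UT : U T = U 0)
  (PT : forall i, P T i i1 = (i == i1)%:R).

Lemma mxsub1E (K : nzRingType) n (A : 'M[K]_n) i j : (A - 1%:M) i j = A i j - (i == j)%:R.
Proof. by rewrite mxE [(- 1%:M : 'M[K]_n) i j]mxE [(1%:M : 'M[K]_n) i j]mxE. Qed.

(** The left side is the derivative of the determinant at [A] in direction [V], as the product rule
    writes it, that is tr (adj A V). With the right null vector e_1 and the left one (-b, 0, 1), the
    adjugate is a multiple of their product, so the trace is a multiple of V_21 - b V_01. *)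
Lemma det_rank_one_defect (K : comNzRingType) (A V : 'M[K]_3) (b : K) :
  (forall i, A i i1 = 0) -> (forall j, A i2 j = b * A i0 j) -> V i2 i1 = b * V i0 i1 ->
  V i0 i0 * (A i1 i1 * A i2 i2 - A i1 i2 * A i2 i1) +
  A i0 i0 * (V i1 i1 * A i2 i2 + A i1 i1 * V i2 i2 +
    - (V i1 i2 * A i2 i1 + A i1 i2 * V i2 i1)) +
  - (V i0 i1 * (A i1 i0 * A i2 i2 - A i1 i2 * A i2 i0) +
  A i0 i1 * (V i1 i0 * A i2 i2 + A i1 i0 * V i2 i2 +
    - (V i1 i2 * A i2 i0 + A i1 i2 * V i2 i0))) +
  (V i0 i2 * (A i1 i0 * A i2 i1 - A i1 i1 * A i2 i0) +
  A i0 i2 * (V i1 i0 * A i2 i1 + A i1 i0 * V i2 i1 +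
    - (V i1 i1 * A i2 i0 + A i1 i1 * V i2 i0))) = 0.
Proof. by move=> h1 h2 h3; rewrite !h1 !h2 h3; ring. Qed.

(* The first integral L v = - v'' + h v of the equation at mu = 0 gives a left null vector
   of M(0) - 1, and the profile derivative a right null vector; since the profile itself
   is periodic, they pair to zero with M'(0). *)
Lemma first_integrals (V1 dV1 : R -> 'M[R]_3) : rdiff V1 dV1 ->
  (forall x, 0 <= x <= T -> dV1 x = Hr g h x 0 *m V1 x - E20 R *m P x) -> V1 0 = 0 ->
  (forall j, (P T - 1%:M) i2 j = h 0 * (P T - 1%:M) i0 j) /\
  V1 T i2 i1 = h 0 * V1 T i0 i1.
Proof.
move=> hV eV V0.
have hT : h T = h 0.
  by have /sh : 0 <= (0 : R) <= T; [rewrite lexx T0|rewrite subr0].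
have zero (f : R -> R) : (forall x : R, 0 <= x <= T -> is_derive x 1 f 0) -> f T = f 0.
  move=> hf; have := @eq_of_derive R f (fun=> 0) (fun=> 0) 0 T T0 hf
    (fun x _ => is_derive_const 0 x).
  by rewrite subrr => /eqP; rewrite subr_eq0 => /eqP.
have hP := rePhi_diff (hPhi 0).
split=> [j|].
  have := zero (fun x => h x * P x i0 j + - P x i2 j); rewrite hT rePhi0 // => H.
  rewrite !mxsub1E.
  suff : h 0 * P T i0 j + - P T i2 j = h 0 * (i0 == j)%:R + - (i2 == j)%:R.
    by rewrite mulrBr; lra.
  have -> : h 0 * (i0 == j)%:R + - (i2 == j)%:R =
      h 0 * (1%:M : 'M[R]_3) i0 j + - (1%:M : 'M[R]_3) i2 j by rewrite !mxE.
  apply: H => x _.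
  have [e0 e1 e2] := sysmx_mul (- 0 - g x) (h x) (P x) j.
  have := is_derive_add (is_derive_mul (dh x) (hP x i0 j)) (is_derive_opp (hP x i2 j)).
  by rewrite e0 e2 => H; apply: (is_derive_eq H); ring.
(* On the inhomogeneous equation the first integral has derivative [P x i0 i1], which is also that
   of [U]; subtracting [U] restores conservation, and [UT] removes the boundary term. *)
have := zero (fun x => h x * V1 x i0 i1 + - V1 x i2 i1 + - U x).
rewrite hT V0 UT !mxE mulr0 oppr0 addr0 => H.
suff : h 0 * V1 T i0 i1 + - V1 T i2 i1 + - U 0 = 0 + - U 0 by lra.
apply: H => x xT.
have [e0 e1 e2] := sysmx_mul (- 0 - g x) (h x) (V1 x) i1.
have d0 : dV1 x i0 i1 = V1 x i1 i1.
  by rewrite eV // mxE e0 mxE E20_mul /= oppr0 addr0.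
have d2 : dV1 x i2 i1 = (- 0 - g x) * V1 x i0 i1 + h x * V1 x i1 i1 - P x i0 i1.
  by rewrite eV // mxE e2 mxE E20_mul.
have := is_derive_add
  (is_derive_add (is_derive_mul (dh x) (hV x i0 i1)) (is_derive_opp (hV x i2 i1)))
  (is_derive_opp (dU xT)).
by rewrite d0 d2 => H'; apply: (is_derive_eq H'); ring.
Qed.

Theorem odd_unstable_eigenvalues :
  0 < complex_derive1n 3 (fun mu => \tr (Phi T mu)) 0 ->
  [/\ 0 < T, exists n, odd n /\
    zero_count (fun mu => \det (Phi T mu - 1%:M)) [set mu : C | 0 < mu] n &
  exists2 r : R, 0 < r & \det (Phi T r%:C - 1%:M) = 0].
Proof.
move=> tr3.
have [w [A [B [hw PhiE BT [V1 [dV1 [hV eV V0 w1]]]]]]] := Phi_expansion cg ch T0 hPhi Phi0.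
have [A0 B0 _] := hw i0 i0.
pose a n := w i0 i0 n + w i1 i1 n + w i2 i2 n.
have ha2 : exp_type (fun n => w i0 i0 n + w i1 i1 n) (2 * A) B.
  split => // [|n]; first by rewrite mulr_ge0.
  have [_ _ /(_ n) h0] := hw i0 i0; have [_ _ /(_ n) h1] := hw i1 i1.
  by apply: le_trans (ler_normD _ _) _; lra.
have ha : exp_type a (3 * A) B.
  split => // [|n]; first by rewrite mulr_ge0.
  have [_ _ /(_ n) h0] := ha2; have [_ _ /(_ n) h1] := hw i2 i2.
  by apply: le_trans (ler_normD _ _) _; lra.
have trE mu : \tr (Phi T mu) = psum a mu.
  rewrite /mxtrace sum3 !PhiE (psum_add mu ha2 (hw i2 i2) ha).
  by rewrite (psum_add mu (hw i0 i0) (hw i1 i1) ha2).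
have a3 : 0 < a 3%N.
  move: tr3; have -> : (fun mu => \tr (Phi T mu)) = psum a by apply/funext.
  rewrite (complex_derive1n_psum 3 ha) (psum0 (exp_type_iter 3 ha)) /= ltcR /dcoef.
  by rewrite !pmulr_rgt0.
have Tp : 0 < T.
  rewrite lt_neqAle T0 andbT; apply/eqP => TE.
  have [_ _ /(_ 3%N)] := ha; rewrite (BT (esym TE)) expr0n /= mulr0 mul0r normr_le0.
  by move: a3 => /gt_eqF ->.
(* The Taylor coefficients of D(mu, 1): twice those of the trace at odd orders and 0 at even
   orders. *)
pose d n := a n - (-1) ^+ n * a n.
have [hd _] := psum_odd_part 0 ha; rewrite -/d in hd.
have DE mu : \det (Phi T mu - 1%:M) = psum d mu.
  by have [_ ->] := psum_odd_part mu ha; rewrite (det_monodromy cg ch T0 sg sh hPhi Phi0) !trE.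
pose p k x := Re (psum (iter k dcoef d) x%:C).
have tp : tower p := psum_tower hd.
have pE k (x : R) : psum (iter k dcoef d) x%:C = (p k x)%:C.
  exact: psum_real (exp_type_iter k hd).
have p_at0 k : p k 0 = iter k dcoef d 0.
  by rewrite /p -[(0 : R)%:C]/(0 : C) (psum0 (exp_type_iter k hd)).
have p0 : p 0%N 0 = 0 by rewrite p_at0 /= /d expr0 mul1r subrr.
have d2 : d 2%N = 0 by rewrite /d sqrrN expr1n mul1r subrr.
have p2 : p 2%N 0 = 0 by rewrite p_at0 /= /dcoef d2 !mulr0.
have p3 : 0 < p 3%N 0.
  rewrite p_at0 /= /dcoef !pmulr_rgt0 // /d -signr_odd /= expr1 mulN1r opprK.
  exact: addr_gt0.
(* Along the real axis the entries [e i j] of M - 1 have value [P T - 1] and derivative [V1 T] at 0;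
   the product rule on the expanded determinant gives the expression of [det_rank_one_defect]. *)
have p1 : p 1%N 0 = 0.
  have [row col] := first_integrals hV eV V0.
  pose e i j (x : R) := Re (psum (w i j) x%:C) + - (i == j)%:R.
  have de i j : is_derive (0 : R) 1 (e i j) (V1 T i j).
    have := is_derive_add (is_derive_psum_real 0 (hw i j))
      (is_derive_const (- (i == j)%:R) (0 : R)).
    rewrite -[(0 : R)%:C]/(0 : C) (psum0 (exp_type_dcoef (hw i j))) /= /dcoef.
    by rewrite w1 mul1r addr0.
  have e0 i j : e i j 0 = (P T - 1%:M) i j.
    by rewrite /e -PhiE mxsub1E [P T i j]mxE.
  have pdet : p 0%N = fun x => e i0 i0 x * (e i1 i1 x * e i2 i2 x + - (e i1 i2 x * e i2 i1 x))
    + - (e i0 i1 x * (e i1 i0 x * e i2 i2 x + - (e i1 i2 x * e i2 i0 x)))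
    + e i0 i2 x * (e i1 i0 x * e i2 i1 x + - (e i1 i1 x * e i2 i0 x)).
    apply/funext => x.
    have -> : p 0%N x = Re (\det (Phi T x%:C - 1%:M)) by rewrite DE.
    have -> : Phi T x%:C - 1%:M = map_mx toC (\matrix_(i, j) e i j x).
      apply/matrixP => i j; rewrite !mxE PhiE (psum_real x (hw i j)) rmorphD rmorphN.
      by rewrite rmorph_nat.
    by rewrite det_map_mx /= det3 !mxE.
  have mm i j k l i' j' k' l' := is_derive_add (is_derive_mul (de i j) (de k l))
    (is_derive_opp (is_derive_mul (de i' j') (de k' l'))).
  have := is_derive_add (is_derive_add
    (is_derive_mul (de i0 i0) (mm i1 i1 i2 i2 i1 i2 i2 i1))
    (is_derive_opp (is_derive_mul (de i0 i1) (mm i1 i0 i2 i2 i1 i2 i2 i0))))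
    (is_derive_mul (de i0 i2) (mm i1 i0 i2 i1 i1 i1 i2 i0)).
  rewrite -pdet !e0 (det_rank_one_defect (b := h 0)) // => [H|i].
    exact: is_derive_unique (tp 0%N 0) H.
  by rewrite mxsub1E PT subrr.
have [e e0 pos] : exists2 e, 0 < e & forall x, 0 < x <= e -> 0 < p 0%N x.
  have [|//|d3 d30 hd3] := @tower_sign_pos R p 3 0 tp.
    by case=> [|[|[|]]].
  exists (d3 / 2) => [|x /andP[x0 xd]]; first by rewrite divr_gt0.
  by have [+ _] := hd3 x; apply; rewrite x0 add0r; lra.
have [K neg] : exists K : R, forall x, K <= x -> p 0%N x < 0.
  have [K hK] := det_monodromy_neg cg ch T0 hPhi Phi0 Tp.
  by exists K => x /hK; rewrite DE.
(* To the right of every [x] there is a point where the function is negative, so it cannot vanish to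
   infinite order at [x]. *)
have /choice[m hm] (x : R) : exists n, order_at p x n.
  pose x1 := Num.max x K + 1.
  have [x1x x1K] : x < x1 /\ K <= x1.
    have [h1 h2] : x <= Num.max x K /\ K <= Num.max x K by rewrite !le_max !lexx orbT.
    by rewrite /x1; split; lra.
  apply: (@order_exists R p x x1 tp x1x); first by rewrite lt_eqF // neg.
  have [dA dB _] := hd.
  exists (2 * (3 * A) * expR (B * (`|x| + `|x1|))), B; split => //.
    by rewrite mulr_ge0 // expR_ge0.
  move=> k y /andP[y1 y2].
  apply: le_trans (psumP y%:C (exp_type_iter k hd)).2 _.
  rewrite nm_real mulrAC; apply: ler_wpM2r; first by rewrite exprn_ge0.
  apply: ler_wpM2l => //; rewrite ler_expR; apply: ler_wpM2l => //.
  rewrite ler_norml; apply/andP; split.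
    by have := ler_norm (- x); rewrite normrN; have := normr_ge0 x1; lra.
  by have := ler_norm x1; have := normr_ge0 x; lra.
have [|//|x|s [us hs os]] := odd_zero_count tp hm e0 (b := Num.max e K).
- by rewrite le_max lexx.
- by rewrite ge_max => /andP[_ /neg].
have D0 (x : R) : \det (Phi T x%:C - 1%:M) = (p 0%N x)%:C by rewrite DE (pE 0%N).
split => //; last first.
  case: s us hs os => [|r s] _ hs; first by rewrite big_nil.
  have [r0 pr] : 0 < r /\ p 0%N r = 0 by apply/hs; rewrite mem_head.
  by exists r => //; rewrite D0 pr.
exists (\sum_(z <- s) m z)%N; split => //.
exists [seq x%:C | x <- s], (fun z => m (Re z)); split.
- by rewrite map_inj_uniq //; exact: complexI.
- move=> z; split => [/mapP[x /hs[x0 px] ->]|].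
    by split; [rewrite /= ltcR|rewrite D0 px].
  (* In the order of the complex numbers 0 < z forces z to be real, so the real zeros exhaust the
     set. *)
  case: z => [x y] []; rewrite /= ltcE /= => /andP[/eqP -> x0] Dz.
  have px : p 0%N x = 0.
    by apply: (@complexI R); rewrite -D0; exact: Dz.
  by apply/mapP; exists x; [exact: (hs x).2 (conj x0 px)|].
- move=> z /mapP[x xs ->] /=; have [h1 h2] := hm x.
  have -> : (fun mu => \det (Phi T mu - 1%:M)) = psum d by apply/funext.
  split => [k km|]; rewrite (complex_derive1n_psum _ hd) pE; first by rewrite h1.
  by apply/eqP => /(@complexI R _ 0) E; move: h2; rewrite E eqxx.
- by rewrite big_map; apply: eq_bigr.
Qed.

End Instability.

(** * Bloch waves and the travelling wave *)

Section BlochWave.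
Context {R : realType}.
Local Notation C := R[i].
Local Notation nm := (@Normc.normc R).
Variables (g h : R -> R) (cg : continuous g) (ch : continuous h).

(** Negative [x] are reached by reversing time, which changes the sign of the matrix; periodicity on
    the whole line needs them. *)
Lemma Hm_unique n (mu : C) (Y Z : R -> 'M[C]_(3, n)) :
  mdiff Y (fun x => Hm g h x mu *m Y x) -> mdiff Z (fun x => Hm g h x mu *m Z x) ->
  Y 0 = Z 0 -> forall x, Y x = Z x.
Proof.
move=> hY hZ YZ0 x; have [x0|x0] := leP 0 x.
  have [K K0 hK] := Hm_bounded cg ch x0.
  apply: (@lin_unique R 3 n (K + nm mu) x Y _ Z _ (fun x => Hm g h x mu) _ x0 hY hZ) => //.
  - by rewrite addr_ge0 // nm_ge0.
  - by move=> t i j; exact: hK.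
  - by rewrite x0 lexx.
have x1 : 0 <= - x by rewrite oppr_ge0 ltW.
have copp (k : R -> R) : continuous k -> continuous (fun t => k (- t)).
  by move=> ck t; apply: (@continuous_comp _ _ _ -%R k); [exact: opp_continuous|exact: ck].
have [K K0 hK] := Hm_bounded (copp _ cg) (copp _ ch) x1.
have rev (W : R -> 'M[C]_(3, n)) : mdiff W (fun x => Hm g h x mu *m W x) ->
    mdiff (fun t => W (- t)) (fun t => (-1 *: Hm g h (- t) mu) *m W (- t)).
  move=> hW i j; have := cdiff_affine (-1) 0 (hW i j).
  have -> : (fun t => W (-1 * t + 0) i j) = (fun t => W (- t) i j).
    by apply/funext => t; rewrite mulN1r addr0.
  move=> H; apply: cdiff_ext H _ => t.
  by rewrite mulN1r addr0 -scalemxAl [RHS]mxE (rmorphN1 (real_complex R)).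
rewrite -[x]opprK.
apply: (@lin_unique R 3 n (K + nm mu) (- x) _ _ _ _ (fun t => -1 *: Hm g h (- t) mu) _ x1
  (rev Y hY) (rev Z hZ)) => //.
- by rewrite addr_ge0 // nm_ge0.
- move=> t i j tx; rewrite mxE mulN1r normcN; exact: (hK mu t i j tx).
- by rewrite oppr0.
- by rewrite x1 lexx.
Qed.

Variables (T : R) (T0 : 0 < T).
Hypotheses (pg : forall x, g (x + T) = g x) (ph : forall x, h (x + T) = h x).

Lemma periodic_bounded (psi dpsi : R -> C) : cdiff psi dpsi ->
  (forall x, psi (x + T) = psi x) -> exists K : R, forall x, nm (psi x) <= K.
Proof.
move=> hpsi per; have [c1 c2] := cdiff_continuous hpsi.
have [K1 _ h1] := bounded_on c1 (ltW T0); have [K2 _ h2] := bounded_on c2 (ltW T0).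
have pern n x : psi (x + n%:R * T) = psi x.
  elim: n => [|n IH]; first by rewrite mul0r addr0.
  by rewrite -natr1 mulrDl mul1r addrA per.
have perz (z : int) x : psi (x + z%:~R * T) = psi x.
  case: z => n; first exact: pern.
  rewrite NegzE mulrNz mulNr; have := pern n.+1 (x - n.+1%:R * T).
  by rewrite subrK.
exists (K1 + K2) => x; set z := Num.floor (x / T).
have -> : psi x = psi (x - z%:~R * T) by rewrite -(perz z (x - z%:~R * T)) subrK.
have /andP[z1 z2] : z%:~R <= x / T < (z + 1)%:~R by exact: floor_itv.
have xT : 0 <= x - z%:~R * T <= T.
  rewrite subr_ge0 -ler_pdivlMr // z1 /= lerBlDl.
  by move: z2; rewrite ltr_pdivrMr // intrD mulrDl mul1r => /ltW.
by apply: le_trans (nm_le _) _; apply: lerD; [exact: h1|exact: h2].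
Qed.

Variables (mu : C) (Phi : R -> 'M[C]_3).
Hypotheses (hPhi : mdiff Phi (fun x => Hm g h x mu *m Phi x)) (Phi0 : Phi 0 = 1%:M)
  (det0 : \det (Phi T - 1%:M) = 0).

Lemma bloch_wave : exists y0 y1 y2 : R -> C,
  [/\ cdiff y0 y1, cdiff y1 y2,
    cdiff y2 (fun x => (- mu - (g x)%:C) * y0 x + (h x)%:C * y1 x),
    exists x, y0 x != 0 & exists K : R, forall x, nm (y0 x) <= K].
Proof.
have [v v0 hv] : exists2 v : 'rV_3, v != 0 & v *m (Phi T - 1%:M)^T = 0.
  by apply/det0P; rewrite det_tr det0.
pose w := v^T.
have Pw : Phi T *m w = w.
  apply/eqP; rewrite -subr_eq0 -[X in _ - X]mul1mx -mulmxBl.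
  by rewrite -[Phi T - _]trmxK -trmx_mul hv trmx0.
pose y i x := (Phi x *m w) i ord0.
have hYw : mdiff (fun x => Phi x *m w) (fun x => Hm g h x mu *m (Phi x *m w)).
  by apply: mdiff_ext (mdiff_mulr w hPhi) _ _ => x //; rewrite mulmxA.
have E x := sysmx_mul (- mu - (g x)%:C) (h x)%:C (Phi x *m w) ord0.
have d0 : cdiff (y i0) (y i1).
  by apply: cdiff_ext (hYw i0 ord0) _ => x; have [e _ _] := E x.
have d1 : cdiff (y i1) (y i2).
  by apply: cdiff_ext (hYw i1 ord0) _ => x; have [_ e _] := E x.
have d2 : cdiff (y i2) (fun x => (- mu - (g x)%:C) * y i0 x + (h x)%:C * y i1 x).
  by apply: cdiff_ext (hYw i2 ord0) _ => x; have [_ _ e] := E x.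
exists (y i0), (y i1), (y i2); split => //.
  (* If the first component vanished identically, so would its derivatives, which are the other two
     components, and the fixed vector would be 0. *)
  apply: contrapT => /forallNP nz.
  have z0 x : y i0 x = 0 by apply/eqP; apply: contrapT => /negP; exact: nz.
  have null (p q : R -> C) : cdiff p q -> (forall x, p x = 0) -> forall x, q x = 0.
    move=> pq p0 x; have : cdiff p (fun=> 0).
      have -> : p = (fun=> 0) by exact/funext.
      exact: cdiff_cst.
    move=> p1; have [a1 a2] := pq x; have [b1 b2] := p1 x.
    by apply: complex_ext; [exact: is_derive_unique a1 b1|exact: is_derive_unique a2 b2].
  have z1 := null _ _ d0 z0; have z2 := null _ _ d1 z1.
  move/eqP: v0; apply; rewrite -[v]trmxK -/w -[w]mul1mx -Phi0.
  suff -> : Phi 0 *m w = 0 by rewrite trmx0.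
  apply/matrixP => i j; rewrite (ord1 j) [RHS]mxE -/(y i 0).
  by move: i; apply: ord3P.
apply: periodic_bounded d0 _ => x.
(* The translate by [T] solves the same system and starts from [Phi T *m w = w]; uniqueness gives
   periodicity. *)
have hS : mdiff (fun x => Phi (x + T) *m w) (fun x => Hm g h x mu *m (Phi (x + T) *m w)).
  move=> i j; have := cdiff_affine 1 T (hYw i j).
  have -> : (fun x => (Phi (1 * x + T) *m w) i j) = (fun x => (Phi (x + T) *m w) i j).
    by apply/funext => t; rewrite mul1r.
  move=> H; apply: cdiff_ext H _ => t.
  by rewrite mul1r (rmorph1 (real_complex R)) mul1r /Hm pg ph.
have := Hm_unique hS hYw _ x; rewrite add0r Pw Phi0 mul1mx => /(_ erefl) e.
by rewrite /y e.
Qed.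

End BlochWave.

(** * The wave profile and its linearization *)

Section Profile.
Context {R : realType}.
Local Notation C := R[i].

Lemma derivable_is_derive1 (k : R -> R) (x : R) : derivable k x 1 -> is_derive x 1 k (derive1 k x).
Proof. by move=> dk; rewrite derive1E; exact: derivableP. Qed.

Variables (f F : R -> R) (a E c um up T : R) (u : R -> R) (Phi : R -> C -> 'M[C]_3).
Hypotheses (f_C2 : C2 f) (F_primitive : forall x : R, is_derive x 1 F (f x))
  (well : potential_well F a E c um up) (T_period : is_period F a E c um up T)
  (u_profile : wave_profile f F a E c um T u) (Phi_fundamental : fundamental_matrix f c u Phi).

Let g x := derive1 u x * derive1n 2 f (u x).
Let h x := - derive1 f (u x) + c.
Let l := derive1n 2 u 0.

Lemma profile_d1 (x : R) : is_derive x 1 u (derive1 u x).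
Proof. by apply: derivable_is_derive1; case: u_profile. Qed.

Lemma profile_d2 (x : R) : is_derive x 1 (derive1 u) (derive1n 2 u x).
Proof. by apply: (derivable_is_derive1 (k := derive1 u)); case: u_profile. Qed.

Lemma profile_d2E x : derive1n 2 u x = a - f (u x) + c * u x.
Proof. by have := profile_ode u_profile x; lra. Qed.

Lemma f_d1 (x : R) : is_derive x 1 f (derive1 f x).
Proof. by apply: derivable_is_derive1; case: f_C2. Qed.

Lemma f_d2 (x : R) : is_derive x 1 (derive1 f) (derive1n 2 f x).
Proof. by apply: (derivable_is_derive1 (k := derive1 f)); case: f_C2. Qed.

Lemma h_derive (x : R) : is_derive x 1 h (- g x).
Proof.
have := is_derive_add (is_derive_opp (is_derive1_comp (f_d2 (u x)) (profile_d1 x)))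
  (is_derive_const c x).
by rewrite addr0 [derive1n 2 f _ * _]mulrC.
Qed.

Lemma h_continuous : continuous h.
Proof. by move=> x; exact: is_derive_continuous (h_derive x). Qed.

Lemma g_continuous : continuous g.
Proof.
move=> x; apply: cvgM; first exact: (is_derive_continuous (profile_d2 x)).
apply: (@continuous_comp _ _ _ u (derive1n 2 f)).
  exact: (is_derive_continuous (profile_d1 x)).
by have [_ _ cf] := f_C2; exact: cf.
Qed.

Lemma period_ge0 : 0 <= T.
Proof.
rewrite -lee_fin T_period; apply: mule_ge0 => //.
by apply: integral_ge0 => v _; rewrite lee_fin invr_ge0 sqrtr_ge0.
Qed.

Lemma profile_d1_periodic x : derive1 u (x + T) = derive1 u x.
Proof.
have H := @is_derive_affine R u x (derive1 u (1 * x + T)) 1 T (profile_d1 _).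
have e : (fun y : R => u (1 * y + T)) = u.
  by apply/funext => y; rewrite mul1r (profile_periodic u_profile).
by rewrite e !mul1r in H; exact: is_derive_unique H (profile_d1 x).
Qed.

(* Both sides solve the second order equation with the same data at x = 0. *)
Lemma profile_reflection x : 0 <= x <= T ->
  u (T - x) = u x /\ derive1 u (T - x) = - derive1 u x.
Proof.
have T0 := period_ge0.
have cu : continuous u by move=> y; exact: is_derive_continuous (profile_d1 y).
have [B B0 hB] := bounded_on cu T0.
(* The shift moves [-B, B], which contains the values of [u] on [0, T], to [0, 2 B], where
   [bounded_on] applies; this bounds f' and makes [f] Lipschitz there. *)
have cf : continuous (fun t => derive1 f (t - B)).
  move=> t; apply: (@continuous_comp _ _ _ (fun t : R => t - B) (derive1 f)).
    by apply: cvgB; [exact: cvg_id|exact: cvg_cst].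
  exact: is_derive_continuous (f_d2 _).
have B2 : 0 <= B + B by rewrite addr_ge0.
have [L L0 hL] := bounded_on cf B2.
have lip s t : `|s| <= B -> `|t| <= B -> `|f s - f t| <= L * `|s - t|.
  wlog st : s t / t < s.
    move=> H hs ht; have [st|st|->] := ltgtP t s; first exact: H.
      by rewrite distrC [`|s - t|]distrC; exact: H.
    by rewrite !subrr normr0 mulr0.
  move=> /ler_normlP[s1 s2] /ler_normlP[t1 t2].
  have [z /andP[z1 z2] ->] := mvt_oo st f_d1.
  rewrite normrM; apply: ler_wpM2r => //.
  have := hL (z + B); rewrite addrK; apply.
  by apply/andP; split; lra.
(* [y false] is the reflected profile minus the profile, and [y true] is its derivative. *)
pose y (b : bool) t := if b then - derive1 u (-1 * t + T) + - derive1 u t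
  else u (-1 * t + T) + - u t.
pose dy (b : bool) t := if b then derive1n 2 u (-1 * t + T) + - derive1n 2 u t
  else - derive1 u (-1 * t + T) + - derive1 u t.
have hy b (t : R) : 0 <= t <= T -> is_derive t 1 (y b) (dy b t).
  move=> _; case: b; rewrite /y /dy.
    have := is_derive_add (is_derive_opp (is_derive_affine (profile_d2 (-1 * t + T))))
      (is_derive_opp (profile_d2 t)).
    by move=> H; apply: (is_derive_eq H); rewrite !mulN1r opprK.
  have := is_derive_add (is_derive_affine (profile_d1 (-1 * t + T))) (is_derive_opp (profile_d1 t)).
  by move=> H; apply: (is_derive_eq H); rewrite !mulN1r.
have bnd b t : 0 <= t <= T -> `|dy b t| <= (1 + L + `|c|) * (\sum_j `|y j t|).
  move=> /andP[t0 tT]; rewrite big_bool /=.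
  have n0 := normr_ge0 (y true t); have n1 := normr_ge0 (y false t).
  have nc := normr_ge0 c.
  case: b; last first.
    have -> : dy false t = y true t by [].
    by rewrite -subr_ge0; nra.
  have -> : dy true t = (f (u t) - f (u (-1 * t + T))) + c * y false t.
    by rewrite /dy /y !profile_d2E; ring.
  apply: le_trans (ler_normD _ _) _; rewrite normrM.
  have : `|f (u t) - f (u (-1 * t + T))| <= L * `|u t - u (-1 * t + T)|.
    apply: lip; apply: hB; first by rewrite t0.
    by apply/andP; split; lra.
  have -> : `|u t - u (-1 * t + T)| = `|y false t| by rewrite distrC.
  by rewrite -subr_ge0 => H; rewrite -subr_ge0; nra.
have y0 b : y b 0 = 0.
  have uT : u T = u 0 by rewrite -[T]add0r (profile_periodic u_profile).
  have u'T : derive1 u T = derive1 u 0 by rewrite -[T]add0r profile_d1_periodic.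
  by case: b; rewrite /y mulr0 add0r ?uT ?u'T ?(profile_init1 u_profile) ?oppr0 ?addr0 ?subrr.
have K0 : 0 <= 1 + L + `|c| by rewrite !addr_ge0.
move=> xT; have H := gronwall0 K0 T0 hy bnd y0.
have := H true x xT; have := H false x xT.
by rewrite /y !mulN1r [- x + T]addrC => h1 h2; split; lra.
Qed.

Lemma g_reflection x : 0 <= x <= T -> g (T - x) = - g x.
Proof. by move=> /profile_reflection[h1 h2]; rewrite /g h1 h2 mulNr. Qed.

Lemma h_reflection x : 0 <= x <= T -> h (T - x) = h x.
Proof. by move=> /profile_reflection[h1 _]; rewrite /h h1. Qed.

Lemma Phi_mdiff mu : mdiff (Phi^~ mu) (fun x => Hm g h x mu *m Phi x mu).
Proof. by move=> i j; apply/cdiffP; have [_ H] := Phi_fundamental mu; exact: H. Qed.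

Lemma Phi_init mu : Phi 0 mu = 1%:M.
Proof. by have [] := Phi_fundamental mu. Qed.

(** At x = 0 the second order equation reads u'' = - V'(um), and [um] is a simple root of V = E. *)
Lemma profile_curvature_neq0 : l != 0.
Proof.
have [_ [_ _ rn] _ _] := well.
suff E1 : derive1 (potential F a c) um = - l by move: rn; rewrite E1 oppr_eq0.
rewrite derive1E /l profile_d2E (profile_init u_profile).
have := is_derive_add (is_derive_add (F_primitive um)
  (is_derive_opp (is_derive_scale (c / 2)
    (is_derive_mul (is_derive_id um (1 : R)) (is_derive_id um (1 : R))))))
  (is_derive_opp (is_derive_scale a (is_derive_id um (1 : R)))).
have -> : (fun y : R => F y + - (c / 2 * (id y * id y)) + - (a * id y)) = potential F a c.
  by apply/funext => y; rewrite /potential expr2.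
by move=> [_ ->]; field.
Qed.

(** (u_x, u_xx, u_xxx) / u''(0), the third entry being written through u_xxx = h u_x. The
    normalisation makes it the second unit vector at x = 0. *)
Definition profile_column x : 'M[R]_(3, 1) :=
  \matrix_(i, j) nth 0 [:: derive1 u x / l; derive1n 2 u x / l; h x * (derive1 u x / l)] i.

Lemma Phi_column x i : 0 <= x <= T -> Phi x (0 : R)%:C i i1 = (profile_column x i ord0)%:C.
Proof.
move=> xT.
have h1 (t : R) : is_derive t 1 (fun t => derive1 u t / l) (derive1n 2 u t / l).
  by have := is_derive_scale l^-1 (profile_d2 t); rewrite mulrC; under eq_fun do rewrite mulrC.
have h2 (t : R) : is_derive t 1 (fun t => derive1n 2 u t / l) (h t * (derive1 u t / l)).
  have := is_derive_scale l^-1 (is_derive_add (is_derive_add (is_derive_const a t)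
    (is_derive_opp (is_derive1_comp (f_d1 (u t)) (profile_d1 t))))
    (is_derive_scale c (profile_d1 t))).
  have -> : (fun y : R => l^-1 * (a + - (f \o u) y + c * u y)) = (fun t => derive1n 2 u t / l).
    by apply/funext => s; rewrite profile_d2E mulrC.
  by move=> H; apply: (is_derive_eq H); rewrite /h; ring.
have hq : rdiff profile_column (fun t => Hr g h t 0 *m profile_column t).
  move=> t i' j; have [e0 e1 e2] := sysmx_mul (- 0 - g t) (h t) (profile_column t) j.
  under eq_fun do rewrite mxE.
  move: i'; apply: ord3P; rewrite /= ?e0 ?e1 ?e2 !mxE /=; [exact: h1|exact: h2|].
  have H := is_derive_mul (h_derive t) (h1 t); apply: (is_derive_eq H).
  by rewrite -[derive1 (derive1 u) t]/(derive1n 2 u t); ring.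
have hq' : mdiff (fun t => map_mx (real_complex R) (profile_column t))
    (fun t => Hm g h t (0 : R)%:C *m map_mx (real_complex R) (profile_column t)).
  have := rdiff_mdiff hq => H; apply: mdiff_ext H _ _ => t //.
  by rewrite map_mxM -Hm_real.
have hp : mdiff (fun t => Phi t (0 : R)%:C *m (delta_mx i1 ord0 : 'M[C]_(3, 1)))
    (fun t => Hm g h t (0 : R)%:C *m (Phi t (0 : R)%:C *m delta_mx i1 ord0)).
  by apply: mdiff_ext (mdiff_mulr _ (Phi_mdiff (0 : R)%:C)) _ _ => t //; rewrite mulmxA.
have pick (A : 'M[C]_3) : (A *m (delta_mx i1 ord0 : 'M[C]_(3, 1))) i ord0 = A i i1.
  by rewrite mxE sum3 !mxE /= !mulr0 mulr1 add0r addr0.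
have := Hm_unique g_continuous h_continuous hp hq' _ x => H.
rewrite -(pick (Phi x (0 : R)%:C)) H ?mxE //.
rewrite Phi_init mul1mx; apply/matrixP; apply: ord3P => j; rewrite (ord1 j) !mxE /=.
- by rewrite (profile_init1 u_profile) mul0r.
- by rewrite -/l divff // profile_curvature_neq0.
- by rewrite (profile_init1 u_profile) mul0r mulr0.
Qed.

Lemma profile_spectrum mu : 0 < T -> \det (Phi T mu - 1%:M) = 0 -> spectrum f c u mu.
Proof.
move=> Tp d0.
have pu x : u (x + T) = u x by exact: profile_periodic u_profile x.
have pg x : g (x + T) = g x by rewrite /g pu profile_d1_periodic.
have ph x : h (x + T) = h x by rewrite /h pu.
have [y0 [y1 [y2 [e0 e1 e2 nz [K hK]]]]] := bloch_wave g_continuous h_continuous Tp pg ph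
  (Phi_mdiff mu) (Phi_init mu) d0.
have [c0 D0] := (cdiffP _ _).1 e0; have [c1 D1] := (cdiffP _ _).1 e1.
have E0 : cderive y0 = y1 by apply/funext.
have E1 : cderive y1 = y2 by apply/funext.
have LE : linop f c u y0 = fun x => - y2 x + (h x)%:C * y0 x.
  apply/funext => x; rewrite /linop E0 E1 /h (rmorphD (real_complex R)) (rmorphN (real_complex R)).
  by ring.
have hL : cdiff (linop f c u y0) (fun x => mu * y0 x).
  rewrite LE; have hh : cdiff (fun x => (h x)%:C) (fun x => (- g x)%:C).
    by apply: cdiff_real => x; exact: h_derive.
  (* In the derivative of - y2 + h y0 the terms in h cancel, and those in g cancel because h' = - g;
     what remains is mu y0. *)
  apply: cdiff_ext (cdiffD (cdiffN e2) (cdiffM hh e0)) _ => x.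
  by rewrite (rmorphN (real_complex R)); ring.
have [cL DL] := (cdiffP _ _).1 hL.
exists y0; split; [split|exact: nz|].
- exact: c0.
- by rewrite E0; exact: c1.
- exact: cL.
- exact: DL.
- by exists K => x; rewrite (normr_nm (y0 x)) lecR; exact: hK.
Qed.

Lemma profile_instability :
  0 < complex_derive1n 3 (fun mu => \tr (Phi T mu)) 0 ->
  [/\ 0 < T, exists n, odd n /\
    zero_count (fun mu => \det (Phi T mu - 1%:M)) [set mu : C | 0 < mu] n &
  exists2 r : R, 0 < r & \det (Phi T r%:C - 1%:M) = 0].
Proof.
have T0 := period_ge0.
have PE x i : 0 <= x <= T -> rePhi Phi 0 x i i1 = profile_column x i ord0.
  by move=> xT; rewrite mxE (Phi_column i xT).
apply: (@odd_unstable_eigenvalues R g h g_continuous h_continuous T T0 h_derive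
  g_reflection h_reflection Phi Phi_mdiff Phi_init (fun x => u x / l)).
- move=> x xT; rewrite (PE x i0 xT) mxE /=.
  by have := is_derive_scale l^-1 (profile_d1 x); rewrite mulrC; under eq_fun do rewrite mulrC.
- by rewrite -[T]add0r (profile_periodic u_profile).
- have TT : 0 <= T <= T by rewrite T0 lexx.
  have u'T : derive1 u T = 0 by rewrite -[T]add0r profile_d1_periodic (profile_init1 u_profile).
  have u2T : derive1n 2 u T = l.
    by rewrite /l !profile_d2E -[T]add0r (profile_periodic u_profile).
  apply: ord3P; rewrite (PE T _ TT) mxE.
  + by rewrite /= u'T mul0r.
  + have ll : (l : R) / l = 1 by apply: divff; exact: profile_curvature_neq0.
    by rewrite u2T eqxx; exact: ll.
  + by rewrite /= u'T mul0r mulr0.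
Qed.

End Profile.

Theorem theorem1 (R : realType) (f F : R -> R) (a E c um up T : R)
    (u : R -> R) (Phi : R -> R[i] -> 'M[R[i]]_3)
    (f_C2 : C2 f)
    (F_primitive : forall x : R, is_derive x 1 F (f x))
    (params_interior : interior (parameter_region F) (a, E, c))
    (well : potential_well F a E c um up)
    (T_period : is_period F a E c um up T)
    (u_profile : wave_profile f F a E c um T u)
    (Phi_fundamental : fundamental_matrix f c u Phi) :
  let M := fun mu : R[i] => Phi T mu in
  let D := fun mu lambda : R[i] => \det (M mu - lambda%:M) in
  let trM := fun mu : R[i] => \tr (M mu) in
  0 < complex_derive1n 3 trM 0 ->
  [/\ exists n : nat,
        odd n /\ zero_count (fun mu => D mu 1) [set mu : R[i] | 0 < mu] n,
      (spectrum f c u `&` [set x%:C | x in [set x : R | x != 0]]) !=set0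
    & (spectrum f c u `&` [set mu : R[i] | 0 < complex.Re mu]) !=set0].
Proof.
move=> M D trM tr3.
have [Tp count [r r0 Dr]] :=
  profile_instability f_C2 F_primitive well T_period u_profile Phi_fundamental tr3.
have sr := profile_spectrum f_C2 u_profile Phi_fundamental Tp Dr.
split; first exact: count.
  by exists r%:C; split => //; exists r => //=; rewrite gt_eqF.
by exists r%:C.
Qed.
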